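(* The following is provable in $\mathbf{ZF}$ (no form of the Axiom of Choice is assumed). Let $\mathbf{X}=\langle X,\mu\rangle$ be a strong generalized topological space. Then $\mathbf{GUL(X)}$ holds if and only if, for every pair $A,B$ of non-empty disjoint $\mu$-closed sets, there exists a collection $\{U_r: r\in\mathbb{Q}\cap(0,1)\}$ of $\mu$-open sets such that: (i) for all $r,s\in\mathbb{Q}\cap(0,1)$, if $r<s$, then $\mathrm{cl}_{\mu}(U_r)\subseteq U_s$; (ii) for every $r\in\mathbb{Q}\cap(0,1)$, $A\subseteq U_r$; (iii) for every $r\in\mathbb{Q}\cap(0,1)$, $\mathrm{cl}_{\mu}(U_r)\subseteq X\setminus B$.
   Context: A generalized topology in a set $X$ is a collection $\mu$ of subsets of $X$ closed under arbitrary unions (so $\emptyset\in\mu$; closure under finite intersections is not required). It is strong if $X\in\mu$. A (strong) generalized topological space is a pair $\mathbf{X}=\langle X,\mu\rangle$ with $\mu$ a (strong) generalized topology in $X$. A set $A\subseteq X$ is $\mu$-open if $A\in\mu$ and $\mu$-closed if $X\setminus A\in\mu$; $\mathrm{cl}_\mu(A)$ is the intersection of all $\mu$-closed sets containing $A$. For generalized topological spaces $\langle X,\mu_X\rangle$, $\langle Y,\mu_Y\rangle$, a map $f:X\to Y$ is $\langle\mu_X,\mu_Y\rangle$-continuous if $f^{-1}[V]\in\mu_X$ for every $V\in\mu_Y$. $g\tau_n=\{\emptyset,\mathbb{R}\}\cup\{(-\infty,a):a\in\mathbb{R}\}\cup\{(a,+\infty):a\in\mathbb{R}\}\cup\{(-\infty,a)\cup(b,+\infty):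 a,b\in\mathbb{R},\ a\leq b\}$, a generalized topology in $\mathbb{R}$. $\mathbf{GUL(X)}$ is the statement: for every pair $A,B$ of disjoint $\mu$-closed sets there exists a $\langle\mu,g\tau_n\rangle$-continuous $f:X\to\mathbb{R}$ with $A\subseteq f^{-1}[\{0\}]$ and $B\subseteq f^{-1}[\{1\}]$. *)

(* Defs.v *)
From Stdlib Require Import List.
Import ListNotations.

(** First-order formulas over the signature {=, ∈}, with De Bruijn indices;
    variables are the only terms. *)
Inductive form : Type :=
| Eq  (i j : nat)
| Mem (i j : nat)
| Bot
| Imp (p q : form)
| All (p : form).

Definition up (s : nat -> nat) (i : nat) : nat :=
  match i with 0 => 0 | S j => S (s j) end.

Fixpoint ren (s : nat -> nat) (p : form) : form :=
  match p with
  | Eq i j  => Eq (s i) (s j)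
  | Mem i j => Mem (s i) (s j)
  | Bot     => Bot
  | Imp p q => Imp (ren s p) (ren s q)
  | All p   => All (ren (up s) p)
  end.

Definition inst (t : nat) (i : nat) : nat :=
  match i with 0 => t | S j => j end.

(** Classical natural deduction. The free variables of an axiom in [T] are
    parameters, i.e. the axiom stands for its universal closure; this is why
    [AllI] shifts the context but puts no condition on [T]. *)
Inductive prv (T : form -> Prop) : list form -> form -> Prop :=
| Hyp G p    : In p G -> prv T G p
| Ax G p     : T p -> prv T G p
| ImpI G p q : prv T (p :: G) q -> prv T G (Imp p q)
| ImpE G p q : prv T G (Imp p q) -> prv T G p -> prv T G q
| Raa G p    : prv T (Imp p Bot :: G) Bot -> prv T G p
| AllI G p   : prv T (map (ren S) G) p -> prv T G (All p)
| AllE G p t : prv T G (All p) -> prv T G (ren (inst t) p)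
| EqI G i    : prv T G (Eq i i)
| EqE G p i j : prv T G (Eq i j) ->
                prv T G (ren (inst i) p) -> prv T G (ren (inst j) p).

Definition provable (T : form -> Prop) (p : form) : Prop := prv T [] p.

(** An [fm] is a formula depending on the number [n] of enclosing quantifiers.
    A variable bound by [all] or [ex] is represented by its level, i.e. the
    number of quantifiers outside its binder; at depth [n], level [x] is the
    De Bruijn index [n - S x]. *)
Definition var := nat.
Definition fm  := nat -> form.

Definition eqv  (x y : var) : fm := fun n => Eq (n - S x) (n - S y).
Definition memv (x y : var) : fm := fun n => Mem (n - S x) (n - S y).
Definition imp  (p q : fm) : fm := fun n => Imp (p n) (q n).
Definition neg  (p : fm) : fm := fun n => Imp (p n) Bot.
Definition or   (p q : fm) : fm := imp (neg p) q.
Definition and  (p q : fm) : fm := neg (imp p (neg q)).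
Definition iff  (p q : fm) : fm := and (imp p q) (imp q p).
Definition all  (p : var -> fm) : fm := fun n => All (p n (S n)).
Definition ex   (p : var -> fm) : fm := neg (all (fun x => neg (p x))).

(** The formula [p] with its free variables 0, 1, ..., k-1 replaced by
    [xs = [x0; ...; x(k-1)]] and the other ones kept as parameters. *)
Definition plug (p : form) (xs : list var) : fm := fun n =>
  ren (fun i => match nth_error xs i with
                | Some x => n - S x
                | None   => n + (i - length xs)
                end) p.

Definition sentence (p : fm) : form := p 0.

Declare Scope fm_scope.
Delimit Scope fm_scope with fm.
Bind Scope fm_scope with fm.

Notation "∀ x .. y , p" := (all (fun x => .. (all (fun y => p)) ..))
  (at level 200, x binder, y binder, right associativity) : fm_scope.
Notation "∃ x .. y , p" := (ex (fun x => .. (ex (fun y => p)) ..))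
  (at level 200, x binder, y binder, right associativity) : fm_scope.
Notation "p → q" := (imp p q)
  (at level 99, q at level 200, right associativity) : fm_scope.
Notation "p ↔ q" := (iff p q) (at level 95, no associativity) : fm_scope.
Notation "p ∨ q" := (or p q) (at level 85, right associativity) : fm_scope.
Notation "p ∧ q" := (and p q) (at level 80, right associativity) : fm_scope.
Notation "¬ p" := (neg p) (at level 75, right associativity) : fm_scope.
Notation "x = y" := (eqv x y) (at level 70) : fm_scope.
Notation "x ≠ y" := (neg (eqv x y)) (at level 70) : fm_scope.
Notation "x ∈ y" := (memv x y) (at level 70) : fm_scope.
Notation "x ∉ y" := (neg (memv x y)) (at level 70) : fm_scope.

Local Open Scope fm_scope.

Definition ax_ext : fm := ∀ a b, (∀ x, x ∈ a ↔ x ∈ b) → a = b.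
Definition ax_foundation : fm :=
  ∀ a, (∃ x, x ∈ a) → ∃ x, x ∈ a ∧ ∀ y, y ∈ x → y ∉ a.
Definition ax_pairing : fm := ∀ a b, ∃ c, ∀ x, x ∈ c ↔ x = a ∨ x = b.
Definition ax_union : fm := ∀ a, ∃ u, ∀ x, x ∈ u ↔ ∃ y, y ∈ a ∧ x ∈ y.
Definition ax_power : fm := ∀ a, ∃ p, ∀ x, x ∈ p ↔ ∀ y, y ∈ x → y ∈ a.
Definition ax_infinity : fm :=
  ∃ w, (∃ e, e ∈ w ∧ ∀ x, x ∉ e) ∧
       (∀ x, x ∈ w → ∃ s, s ∈ w ∧ ∀ y, y ∈ s ↔ y ∈ x ∨ y = x).
Definition ax_separation (p : form) : fm :=
  ∀ a, ∃ b, ∀ x, x ∈ b ↔ x ∈ a ∧ plug p [x].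
Definition ax_replacement (p : form) : fm :=
  ∀ a, (∀ x y z, x ∈ a → plug p [x; y] → plug p [x; z] → y = z) →
       ∃ b, ∀ y, y ∈ b ↔ ∃ x, x ∈ a ∧ plug p [x; y].

Inductive ZF : form -> Prop :=
| ZF_ext           : ZF (sentence ax_ext)
| ZF_foundation    : ZF (sentence ax_foundation)
| ZF_pairing       : ZF (sentence ax_pairing)
| ZF_union         : ZF (sentence ax_union)
| ZF_power         : ZF (sentence ax_power)
| ZF_infinity      : ZF (sentence ax_infinity)
| ZF_separation p  : ZF (sentence (ax_separation p))
| ZF_replacement p : ZF (sentence (ax_replacement p)).

Definition nonempty (a : var) : fm := ∃ x, x ∈ a.
Definition subset (a b : var) : fm := ∀ x, x ∈ a → x ∈ b.
Definition disjoint (a b : var) : fm := ∀ x, ¬ (x ∈ a ∧ x ∈ b).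
Definition is_empty (a : var) : fm := ∀ x, x ∉ a.
(** c = a \ b *)
Definition is_diff (c a b : var) : fm := ∀ x, x ∈ c ↔ x ∈ a ∧ x ∉ b.
(** u = ⋃ a *)
Definition is_union (u a : var) : fm := ∀ x, x ∈ u ↔ ∃ y, y ∈ a ∧ x ∈ y.
(** c = {a, b} *)
Definition is_upair (c a b : var) : fm := ∀ x, x ∈ c ↔ x = a ∨ x = b.
(** p = (a, b) = {{a}, {a, b}} *)
Definition is_pair (p a b : var) : fm :=
  ∀ c, c ∈ p ↔ is_upair c a a ∨ is_upair c a b.
(** p = a × b *)
Definition is_prod (p a b : var) : fm :=
  ∀ c, c ∈ p ↔ ∃ x y, x ∈ a ∧ y ∈ b ∧ is_pair c x y.
(** (a, b) ∈ r *)
Definition related (r a b : var) : fm := ∃ p, is_pair p a b ∧ p ∈ r.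
(** f : a → b *)
Definition is_fun (f a b : var) : fm :=
  (∀ p, p ∈ f → ∃ x y, x ∈ a ∧ y ∈ b ∧ is_pair p x y) ∧
  (∀ x, x ∈ a → ∃ y, related f x y ∧ ∀ z, related f x z → z = y).
(** f(x) = y *)
Definition value (f x y : var) : fm := related f x y.
(** f(x, y) = z *)
Definition value2 (f x y z : var) : fm := ∃ p, is_pair p x y ∧ value f p z.
(** w = f⁻¹[v], for f with domain a *)
Definition is_preimage (w f a v : var) : fm :=
  ∀ x, x ∈ w ↔ x ∈ a ∧ ∃ y, y ∈ v ∧ value f x y.

Definition less (lt x y : var) : fm := related lt x y.
Definition lesseq (lt x y : var) : fm := less lt x y ∨ x = y.

Definition ordered_field (R add mul lt zero one : var) : fm :=
  (∃ P, is_prod P R R ∧ is_fun add P R ∧ is_fun mul P R ∧ subset lt P) ∧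
  (zero ∈ R ∧ one ∈ R ∧ zero ≠ one) ∧
  (∀ x y z u v w, x ∈ R → y ∈ R → z ∈ R →
     value2 add x y u → value2 add u z w → value2 add y z v →
     value2 add x v w) ∧
  (∀ x y z, x ∈ R → y ∈ R → value2 add x y z → value2 add y x z) ∧
  (∀ x, x ∈ R → value2 add x zero x) ∧
  (∀ x, x ∈ R → ∃ y, y ∈ R ∧ value2 add x y zero) ∧
  (∀ x y z u v w, x ∈ R → y ∈ R → z ∈ R →
     value2 mul x y u → value2 mul u z w → value2 mul y z v →
     value2 mul x v w) ∧
  (∀ x y z, x ∈ R → y ∈ R → value2 mul x y z → value2 mul y x z) ∧
  (∀ x, x ∈ R → value2 mul x one x) ∧
  (∀ x, x ∈ R → x ≠ zero → ∃ y, y ∈ R ∧ value2 mul x y one) ∧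
  (∀ x y z s u v w, x ∈ R → y ∈ R → z ∈ R →
     value2 add y z s → value2 mul x s w →
     value2 mul x y u → value2 mul x z v →
     value2 add u v w) ∧
  (∀ x, x ∈ R → ¬ less lt x x) ∧
  (∀ x y z, x ∈ R → y ∈ R → z ∈ R →
     less lt x y → less lt y z → less lt x z) ∧
  (∀ x y, x ∈ R → y ∈ R → less lt x y ∨ x = y ∨ less lt y x) ∧
  (∀ x y z u v, x ∈ R → y ∈ R → z ∈ R →
     less lt x y → value2 add x z u → value2 add y z v → less lt u v) ∧
  (∀ x y z, x ∈ R → y ∈ R →
     less lt zero x → less lt zero y → value2 mul x y z → less lt zero z).

Definition upper_bound (lt b s : var) : fm := ∀ x, x ∈ s → lesseq lt x b.

Definition complete_order (R lt : var) : fm :=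
  ∀ s, subset s R → nonempty s → (∃ b, b ∈ R ∧ upper_bound lt b s) →
    ∃ m, m ∈ R ∧ upper_bound lt m s ∧
         ∀ b, b ∈ R → upper_bound lt b s → lesseq lt m b.

(** ℝ is specified as the complete ordered field, unique up to isomorphism. *)
Definition real_field (R add mul lt zero one : var) : fm :=
  ordered_field R add mul lt zero one ∧ complete_order R lt.

(** k contains 1 and is closed under z = x - y and z = x / y. *)
Definition subfield (k R add mul zero one : var) : fm :=
  subset k R ∧ one ∈ k ∧
  (∀ x y z, x ∈ k → y ∈ k → z ∈ R → value2 add z y x → z ∈ k) ∧
  (∀ x y z, x ∈ k → y ∈ k → z ∈ R → y ≠ zero → value2 mul z y x → z ∈ k).

(** ℚ is the smallest subfield of ℝ. *)
Definition rational_subfield (Q R add mul zero one : var) : fm :=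
  subfield Q R add mul zero one ∧
  ∀ k, subfield k R add mul zero one → subset Q k.

(** I = ℚ ∩ (0, 1) *)
Definition rational_unit_interval (I Q lt zero one : var) : fm :=
  ∀ r, r ∈ I ↔ r ∈ Q ∧ less lt zero r ∧ less lt r one.

(** N = gτₙ *)
Definition is_gtau_n (N R lt : var) : fm :=
  ∀ v, v ∈ N ↔
    is_empty v ∨ v = R ∨
    (∃ a, a ∈ R ∧ ∀ x, x ∈ v ↔ x ∈ R ∧ less lt x a) ∨
    (∃ a, a ∈ R ∧ ∀ x, x ∈ v ↔ x ∈ R ∧ less lt a x) ∨
    (∃ a b, a ∈ R ∧ b ∈ R ∧ lesseq lt a b ∧
       ∀ x, x ∈ v ↔ x ∈ R ∧ (less lt x a ∨ less lt b x)).

Definition gen_top (X mu : var) : fm :=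
  (∀ u, u ∈ mu → subset u X) ∧
  (∀ s, subset s mu → ∃ u, is_union u s ∧ u ∈ mu).

Definition strong_gen_top (X mu : var) : fm := gen_top X mu ∧ X ∈ mu.

Definition is_closed (X mu a : var) : fm :=
  subset a X ∧ ∃ c, is_diff c X a ∧ c ∈ mu.

(** c = cl(a) *)
Definition is_closure (X mu c a : var) : fm :=
  ∀ x, x ∈ c ↔ ∀ F, is_closed X mu F → subset a F → x ∈ F.

Definition continuous (f X mu nu : var) : fm :=
  ∀ v, v ∈ nu → ∃ w, is_preimage w f X v ∧ w ∈ mu.

(** The parameters R, N, zero and one stand for ℝ, gτₙ, 0 and 1. *)
Definition GUL (X mu R N zero one : var) : fm :=
  ∀ A B, is_closed X mu A → is_closed X mu B → disjoint A B →
    ∃ f, is_fun f X R ∧ continuous f X mu N ∧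
         (∀ x, x ∈ A → value f x zero) ∧ (∀ x, x ∈ B → value f x one).

(* Main.v *)
Require Import Defs.
From Stdlib Require Import List Arith Lia Ring Cantor.
From Stdlib Require Import Classical ClassicalEpsilon.
From Stdlib Require Import FunctionalExtensionality PropExtensionality.
Import ListNotations.

(** The theorem asserts that a derivation exists. By the completeness theorem
    for this calculus ([completeness]) it is enough to check the sentence in an
    arbitrary model of ZF, where one can reason about the elements of the model
    as about sets. The sets that the argument needs must exist in the model, and
    this is where ZF enters: every one of them is cut out by [separation] from a
    set obtained by pairing, union and power set, with a predicate that is
    [definable] in the model. No choice is made inside the model; the choice
    principles used below only concern the construction and the description of
    models.

    Completeness is Henkin's argument. Variables are the only terms, so they also
    serve as witnesses: a finite context always leaves a fresh variable, and a
    consistent context extends to a chain of contexts that decides every formula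
    and refutes a universal formula only together with one of its instances. The
    variables, identified when the chain proves them equal, form a model
    ([truth]). The encoded connectives of the statement are turned back into
    those of the ambient logic by [reading], after which the statement is, up to
    conversion, the proposition [Sem.characterization].

    In a model, the first step is that the rationals are dense in the reals
    ([rationals_dense]). Induction on natural numbers is avoided: a subfield [Q]
    that was bounded would have a supremum [m], and adding 1 to an element above
    [m - 1] would exceed it; so [Q] has arbitrarily small positive elements [e],
    and an element of [Q] within [e] of the supremum of the elements of [Q]
    below [x] gives, after adding [e], an element of [Q] just above [x].

    If [f] separates [A] from [B], put [U_r = {x | f x < r}]. It is open because
    rays are open for the generalized topology of the reals, and its closure lies
    in the closed set [{x | f x <= r}], which is contained in [U_s] for [s > r]
    and misses [B] ([family_of_function]).

    Conversely, given the family, let [f x] be the supremum of 0 and of the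
    indices [r] for which [x] is outside [U_r]. Density of the indices shows
    that [f x < a] exactly when [1 < a] or [x] lies in some [U_r] with [r < a],
    and that [f x > a] exactly when [a < 0] or some open set around [x] misses
    some [U_r] with [r > a] ([index_sup_lt], [index_sup_gt]). Preimages of rays
    are therefore unions of open sets, and every other open set of reals is
    empty, everything, or a union of two rays, so [f] is continuous even though
    finite intersections of open sets need not be open
    ([function_of_family]). The remaining case, where [A] or [B] is empty, is
    settled by a constant function, whose continuity uses that the whole space
    is open. *)

(** * Renaming and substitution in derivations *)

Definition scons {A} (a : A) (f : nat -> A) (i : nat) : A :=
  match i with 0 => a | S j => f j end.

Lemma ren_ext s t p : (forall i, s i = t i) -> ren s p = ren t p.
Proof. intros E; f_equal; now apply functional_extensionality. Qed.

Lemma ren_ren s t p : ren s (ren t p) = ren (fun i => s (t i)) p.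
Proof.
  revert s t; induction p as [| | |p IHp q IHq|p IHp]; intros s t; cbn;
    [reflexivity..|now rewrite IHp, IHq|].
  rewrite IHp; f_equal; apply ren_ext; now intros [|i].
Qed.

Lemma ren_id p : ren (fun i => i) p = p.
Proof.
  induction p as [| | |p IHp q IHq|p IHp]; cbn;
    [reflexivity..|now rewrite IHp, IHq|].
  rewrite <- IHp at 2; f_equal; apply ren_ext; now intros [|i].
Qed.

Lemma ren_inst_up s t p :
  ren (inst t) (ren (up s) p) = ren (scons t s) p.
Proof. rewrite ren_ren; apply ren_ext; now intros [|i]. Qed.

(** Stated through the action of renamings, so that no syntactic notion of
    free variable is needed. *)
Definition bounded (k : nat) (p : form) : Prop :=
  forall s t, (forall i, i < k -> s i = t i) -> ren s p = ren t p.

Lemma bounded_mono k l p : k <= l -> bounded k p -> bounded l p.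
Proof. intros L B s t E; apply B; intros i H; apply E; lia. Qed.

Lemma bounded_exists p : exists k, bounded k p.
Proof.
  induction p as [i j|i j| |p [k B] q [l C]|p [k B]].
  1,2: exists (S (i + j)); intros s t E; cbn; now rewrite !E by lia.
  - now exists 0.
  - exists (k + l); intros s t E; cbn; f_equal; [apply B|apply C];
      intros; apply E; lia.
  - exists k; intros s t E; cbn; f_equal; apply B.
    intros [|i] H; cbn; [reflexivity|]; now rewrite E by lia.
Qed.

Lemma bounded_list_exists G : exists k, forall p, In p G -> bounded k p.
Proof.
  induction G as [|q G [k B]]; [now exists 0|].
  destruct (bounded_exists q) as [l C]; exists (k + l).
  intros p [<-|H].
  - apply (bounded_mono l); [lia|exact C].
  - apply (bounded_mono k); [lia|now apply B].
Qed.

Section Derivations.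
Variable T : form -> Prop.

Lemma prv_weaken G p : prv T G p -> forall G', incl G G' -> prv T G' p.
Proof.
  induction 1; intros G' I.
  - apply Hyp; auto.
  - now apply Ax.
  - apply ImpI, IHprv; intros q' [<-|H']; cbn; auto.
  - eapply ImpE; eauto.
  - apply Raa, IHprv; intros q' [<-|H']; cbn; auto.
  - apply AllI, IHprv; now apply incl_map.
  - now apply AllE, IHprv.
  - apply EqI.
  - eapply EqE; eauto.
Qed.

Definition alls (k : nat) (p : form) : form := Nat.iter k All p.

Lemma alls_intro k G p : (forall G', prv T G' p) -> prv T G (alls k p).
Proof. intros H; revert G; induction k; intros G; cbn; [auto|apply AllI, IHk]. Qed.

(** Instantiating [k] quantifiers one at a time performs a simultaneous
    substitution. The first variables are instantiated last, and each step
    shifts the variables beyond the bound ones down by one. *)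
Lemma alls_elim k G p s :
  prv T G (alls k p) ->
  prv T G (ren (fun i => if i <? k then s i else i - k) p).
Proof.
  revert p s; induction k as [|k IH]; intros p s H.
  - rewrite (ren_ext _ (fun i => i)); [now rewrite ren_id|].
    intros i; apply Nat.sub_0_r.
  - unfold alls in H; rewrite Nat.iter_succ_r in H.
    apply (IH _ (fun i => s (S i))) in H; cbn [ren] in H.
    apply (AllE _ _ _ (s 0)) in H; rewrite ren_inst_up in H.
    erewrite ren_ext; [exact H|]; now intros [|i].
Qed.

(** An axiom holds for all values of its parameters because quantifying it
    universally leaves the context of axioms untouched. *)
Lemma prv_axiom_instance G p s : T p -> prv T G (ren s p).
Proof.
  intros H; destruct (bounded_exists p) as [k B].
  rewrite (B s (fun i => if i <? k then s i else i - k)).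
  - apply alls_elim, alls_intro; intros; now apply Ax.
  - intros i L; apply Nat.ltb_lt in L; now rewrite L.
Qed.

(** The axioms in [T] are not part of the context, so the case of an axiom needs
    that its instances are derivable. *)
Lemma prv_ren G p s : prv T G p -> prv T (map (ren s) G) (ren s p).
Proof.
  intros H; revert s; induction H; intros s; cbn in *.
  - apply Hyp, in_map; auto.
  - now apply prv_axiom_instance.
  - apply ImpI, IHprv.
  - eapply ImpE; [apply IHprv1|apply IHprv2].
  - apply Raa, IHprv.
  - apply AllI; rewrite map_map.
    specialize (IHprv (up s)); rewrite map_map in IHprv.
    erewrite map_ext; [exact IHprv|].
    intros q; cbn; now rewrite !ren_ren.
  - specialize (IHprv s); apply (AllE _ _ _ (s t)) in IHprv.
    rewrite ren_inst_up in IHprv; rewrite ren_ren.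
    erewrite ren_ext; [exact IHprv|]; now intros [|i].
  - apply EqI.
  - rewrite ren_ren; erewrite ren_ext.
    + rewrite <- ren_inst_up with (s := s) (t := s j).
      eapply EqE; [apply IHprv1|].
      specialize (IHprv2 s); rewrite ren_ren in IHprv2; rewrite ren_inst_up.
      erewrite ren_ext; [exact IHprv2|]; now intros [|k].
    + now intros [|k].
Qed.

(** Generalisation over a variable that occurs neither in the context nor in
    the formula. *)
Lemma prv_generalize G p x :
  (forall q, In q G -> bounded x q) -> bounded x p ->
  prv T G (ren (inst x) p) -> prv T G (All p).
Proof.
  intros BG Bp H; apply AllI.
  (* The renaming that turns [x] into the bound variable and acts as the shift
     required by [AllI] on everything else that occurs. *)
  apply (prv_ren _ _ (fun i => if i <? x then S i else 0)) in H.
  rewrite ren_ren in H.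
  erewrite map_ext_in.
  - rewrite <- (ren_id p), (Bp _ (fun i => (if inst x i <? x then S (inst x i) else 0)));
      [exact H|].
    intros [|i] L; cbn [inst].
    + destruct (Nat.ltb_spec x x); lia.
    + destruct (Nat.ltb_spec i x); lia.
  - intros q Hq; apply BG; [assumption|]; intros i L.
    apply Nat.ltb_lt in L; now rewrite L.
Qed.

End Derivations.

(** * Completeness *)

Fixpoint code (p : form) : nat :=
  match p with
  | Eq i j => to_nat (0, to_nat (i, j))
  | Mem i j => to_nat (1, to_nat (i, j))
  | Bot => to_nat (2, 0)
  | Imp p q => to_nat (3, to_nat (code p, code q))
  | All p => to_nat (4, code p)
  end.

Lemma to_nat_inj a b c d : to_nat (a, b) = to_nat (c, d) -> a = c /\ b = d.
Proof.
  intros E; apply (f_equal of_nat) in E; rewrite !cancel_of_to in E.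
  now injection E.
Qed.

Lemma code_inj p q : code p = code q -> p = q.
Proof.
  revert q; induction p; intros []; cbn [code]; intros H;
    apply to_nat_inj in H as [E H]; try discriminate E;
    try (apply to_nat_inj in H as [H1 H2]); f_equal; auto.
Qed.

Lemma forms_enumerable : exists e : nat -> form, forall p, exists n, e n = p.
Proof.
  exists (fun n => epsilon (inhabits Bot) (fun p => code p = n)).
  intros p; exists (code p); apply code_inj.
  now apply (epsilon_spec (inhabits Bot) (fun q => code q = code p)); exists p.
Qed.

Fixpoint sat {M} (mem : M -> M -> Prop) (rho : nat -> M) (p : form) : Prop :=
  match p with
  | Eq i j => rho i = rho j
  | Mem i j => mem (rho i) (rho j)
  | Bot => False
  | Imp p q => sat mem rho p -> sat mem rho q
  | All p => forall d, sat mem (scons d rho) p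
  end.

Section Henkin.
Variable T : form -> Prop.

Definition consistent (G : list form) : Prop := ~ prv T G Bot.

(** [G] proves or refutes [p]; a refuted universal formula comes with a
    counterexample, the variable [x]. *)
Definition decides (G : list form) (p : form) : Prop :=
  prv T G p \/
  prv T G (Imp p Bot) /\
  forall q, p = All q -> exists x, prv T G (Imp (ren (inst x) q) Bot).

(** The one step of the Henkin construction: if [p] is not provable, its negation
    can be added, and a counterexample to a universal formula can be named by a
    fresh variable, since refuting that counterexample would, by
    generalization, prove the formula. *)
Lemma decide_extension G p :
  consistent G -> exists G', consistent G' /\ incl G G' /\ decides G' p.
Proof.
  intros C; destruct (classic (prv T G p)) as [H|H].
  { exists G; split; [exact C|split; [apply incl_refl|now left]]. }
  assert (C1 : consistent (Imp p Bot :: G)) by (intros D; apply H, Raa, D).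
  destruct (classic (exists q, p = All q)) as [[q ->]|N].
  - destruct (bounded_list_exists (q :: Imp (All q) Bot :: G)) as [x B].
    exists (Imp (ren (inst x) q) Bot :: Imp (All q) Bot :: G).
    split; [|split].
    + intros D; apply C1.
      eapply ImpE; [apply Hyp; now left|].
      apply prv_generalize with x.
      * intros r Hr; apply B; now right.
      * apply B; now left.
      * apply Raa, D.
    + intros r Hr; cbn; auto.
    + right; split; [apply Hyp; cbn; auto|].
      intros r [= <-]; exists x; apply Hyp; cbn; auto.
  - exists (Imp p Bot :: G); split; [exact C1|split].
    + now apply incl_tl, incl_refl.
    + right; split; [apply Hyp; now left|].
      intros q E; destruct N; eauto.
Qed.

Lemma complete_chain G0 :
  consistent G0 ->
  exists G : nat -> list form,
    incl G0 (G 0) /\ (forall n, consistent (G n)) /\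
    (forall n m, n <= m -> incl (G n) (G m)) /\
    (forall p, exists n, decides (G n) p).
Proof.
  intros C0; destruct forms_enumerable as [e He].
  assert (step : forall (G : {G | consistent G}) p,
             {G' : {G | consistent G} |
               incl (proj1_sig G) (proj1_sig G') /\ decides (proj1_sig G') p}).
  { intros [G C] p; apply constructive_indefinite_description.
    destruct (decide_extension G p C) as [G' [C' H]].
    now exists (exist _ G' C'). }
  pose (chain := fix chain n : {G | consistent G} :=
          match n with
          | 0 => exist _ G0 C0
          | S n => proj1_sig (step (chain n) (e n))
          end).
  exists (fun n => proj1_sig (chain n)); split; [apply incl_refl|split; [|split]].
  - intros n; exact (proj2_sig (chain n)).
  - intros n m L; induction L as [|m L IH]; [apply incl_refl|].
    eapply incl_tran; [exact IH|].
    exact (proj1 (proj2_sig (step (chain m) (e m)))).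
  - intros p; destruct (He p) as [n <-]; exists (S n).
    exact (proj2 (proj2_sig (step (chain n) (e n)))).
Qed.

Section TermModel.
Variable G : nat -> list form.
Hypothesis G_consistent : forall n, consistent (G n).
Hypothesis G_chain : forall n m, n <= m -> incl (G n) (G m).
Hypothesis G_decides : forall p, exists n, decides (G n) p.

Definition holds (p : form) : Prop := exists n, prv T (G n) p.

Lemma prv_G_mono n m p : n <= m -> prv T (G n) p -> prv T (G m) p.
Proof. intros L H; eapply prv_weaken; eauto. Qed.

Lemma holds_map2 p q r :
  (forall n, prv T (G n) p -> prv T (G n) q -> prv T (G n) r) ->
  holds p -> holds q -> holds r.
Proof.
  intros H [n Hn] [m Hm]; exists (n + m).
  apply H; [apply (prv_G_mono n)|apply (prv_G_mono m)]; try assumption; lia.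
Qed.

Lemma holds_not_Bot : ~ holds Bot.
Proof. intros [n H]; now apply (G_consistent n). Qed.

Lemma holds_decided p :
  holds p \/
  holds (Imp p Bot) /\
  forall q, p = All q -> exists x, holds (Imp (ren (inst x) q) Bot).
Proof.
  destruct (G_decides p) as [n [H|[H W]]].
  - left; now exists n.
  - right; split; [now exists n|].
    intros q E; destruct (W q E) as [x Hx]; exists x; now exists n.
Qed.

Lemma holds_mp p q : holds (Imp p q) -> holds p -> holds q.
Proof. apply holds_map2; intros n; apply ImpE. Qed.

(** For [Imp] and [All] the right to left direction is where maximality and
    witnesses are used. *)
Lemma holds_Imp p q : holds (Imp p q) <-> (holds p -> holds q).
Proof.
  split; [apply holds_mp|].
  intros H; destruct (holds_decided p) as [Hp|[[n Hn] _]].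
  - destruct (H Hp) as [n Hn]; exists n.
    apply ImpI; eapply prv_weaken; [exact Hn|]; now apply incl_tl, incl_refl.
  - exists n; apply ImpI, Raa.
    eapply ImpE; [|apply Hyp; right; now left].
    eapply prv_weaken; [exact Hn|]; intros r Hr; cbn; auto.
Qed.

Lemma holds_All p : holds (All p) <-> forall x, holds (ren (inst x) p).
Proof.
  split.
  - intros [n Hn] x; exists n; now apply AllE.
  - intros H; destruct (holds_decided (All p)) as [Hp|[_ W]]; [exact Hp|].
    destruct (W p eq_refl) as [x Hx]; destruct holds_not_Bot.
    exact (holds_mp _ _ Hx (H x)).
Qed.

Lemma holds_Eq_subst p i j :
  holds (Eq i j) -> holds (ren (inst i) p) -> holds (ren (inst j) p).
Proof. apply holds_map2; intros n; apply EqE. Qed.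

Lemma holds_Eq_refl i : holds (Eq i i).
Proof. exists 0; apply EqI. Qed.

Lemma holds_Eq_sym i j : holds (Eq i j) -> holds (Eq j i).
Proof.
  intros H; exact (holds_Eq_subst (Eq 0 (S i)) i j H (holds_Eq_refl i)).
Qed.

Lemma holds_Eq_trans i j k : holds (Eq i j) -> holds (Eq j k) -> holds (Eq i k).
Proof. intros H H'; exact (holds_Eq_subst (Eq (S i) 0) j k H' H). Qed.

(** Classes are represented as predicates on variables, so that provably equal
    variables have equal classes in the sense of Leibniz, as [sat] requires. *)
Definition term_model : Type :=
  {P : nat -> Prop | exists i, P = fun j => holds (Eq i j)}.

Definition class (i : nat) : term_model :=
  exist _ (fun j => holds (Eq i j)) (ex_intro _ i eq_refl).

Definition class_mem (a b : term_model) : Prop :=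
  exists i j, a = class i /\ b = class j /\ holds (Mem i j).

Lemma class_surjective a : exists i, a = class i.
Proof. destruct a as [P [i ->]]; now exists i. Qed.

Lemma class_eq i j : class i = class j <-> holds (Eq i j).
Proof.
  split.
  - intros E; apply (f_equal (@proj1_sig _ _)) in E; cbn in E.
    apply (f_equal (fun P => P j)) in E; cbn in E; rewrite E.
    apply holds_Eq_refl.
  - intros H; unfold class.
    assert (E : (fun k => holds (Eq i k)) = fun k => holds (Eq j k)).
    { apply functional_extensionality; intros k; apply propositional_extensionality.
      split; apply holds_Eq_trans; [now apply holds_Eq_sym|exact H]. }
    apply eq_sig_hprop; [intros; apply proof_irrelevance|exact E].
Qed.

Lemma class_mem_class i j : class_mem (class i) (class j) <-> holds (Mem i j).
Proof.
  split.
  - intros (i' & j' & Ei & Ej & H).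
    apply eq_sym, class_eq in Ei; apply eq_sym, class_eq in Ej.
    apply (holds_Eq_subst (Mem 0 (S j')) i' i Ei) in H.
    exact (holds_Eq_subst (Mem (S i) 0) j' j Ej H).
  - intros H; now exists i, j.
Qed.

(** Every environment of the term model comes from a renaming [s], so
    quantification over the model is quantification over variables. *)
Lemma truth p s : sat class_mem (fun i => class (s i)) p <-> holds (ren s p).
Proof.
  revert s; induction p as [i j|i j| |p IHp q IHq|p IHp]; intros s; cbn.
  - apply class_eq.
  - apply class_mem_class.
  - split; [easy|apply holds_not_Bot].
  - now rewrite holds_Imp, IHp, IHq.
  - rewrite holds_All; split; intros H x.
    + rewrite ren_inst_up; apply IHp.
      specialize (H (class x)).
      replace (fun i => class (scons x s i)) with (scons (class x) (fun i => class (s i)));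
        [exact H|].
      apply functional_extensionality; now intros [|i].
    + destruct (class_surjective x) as [k ->].
      specialize (H k); rewrite ren_inst_up in H; apply IHp in H.
      replace (scons (class k) (fun i => class (s i))) with (fun i => class (scons k s i));
        [exact H|].
      apply functional_extensionality; now intros [|i].
Qed.

End TermModel.
End Henkin.

(** A theory is a set of schematic axioms, so a model has to satisfy them for all
    values of their parameters, whereas [p] may be refuted at a single
    environment. *)
Theorem completeness (T : form -> Prop) (p : form) :
  (forall M (mem : M -> M -> Prop),
     (forall rho q, T q -> sat mem rho q) -> forall rho, sat mem rho p) ->
  provable T p.
Proof.
  intros V; apply NNPP; intros N.
  assert (C : consistent T [Imp p Bot]) by (intros D; apply N, Raa, D).
  destruct (complete_chain T _ C) as (G & I & GC & GM & GD).
  pose proof (truth T G GC GM GD) as truth.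
  apply (holds_not_Bot T G GC); apply holds_mp with p; [assumption| |].
  - exists 0; apply Hyp, I; now left.
  - rewrite <- (ren_id p); apply truth, V.
    intros rho q Hq.
    pose (s i := proj1_sig (constructive_indefinite_description _
                   (class_surjective T G (rho i)))).
    replace rho with (fun i => class T G (s i)).
    + apply truth; exists 0; now apply prv_axiom_instance.
    + apply functional_extensionality; intros i; unfold s.
      now destruct constructive_indefinite_description.
Qed.

(** * Reading formulas as propositions *)

Section Reading.
Context {M : Type} (mem : M -> M -> Prop).

(** Formulas have only implication, falsity and universal quantification. The
    function [reading] recognizes the encodings of the other connectives, so
    that the encoded statement computes to the proposition it stands for. Where
    an encoding is ambiguous, the reading chosen is a matter of convenience,
    because every one is equivalent to [sat] ([reading_sat]). *)

(** Whether [Imp p Bot] is meant as a conjunction. *)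
Definition refutes_conjunction (p : form) : bool :=
  match p with
  | Imp _ (Imp _ Bot) => true
  | _ => false
  end.

(** Whether [Imp p Bot] is meant as a conjunction or as an existential statement.
    A universally quantified conjunction also has the shape [All (Imp q Bot)];
    its negation is not taken for an existential statement. *)
Definition encodes_connective (p : form) : bool :=
  match p with
  | All (Imp q Bot) => negb (refutes_conjunction q)
  | _ => refutes_conjunction p
  end.

Fixpoint reading (rho : nat -> M) (p : form) : Prop :=
  match p with
  | Eq i j => rho i = rho j
  | Mem i j => mem (rho i) (rho j)
  | Bot => False
  | All p => forall d, reading (scons d rho) p
  | Imp p Bot =>
      match p with
      | All (Imp q Bot) =>
          if refutes_conjunction q then ~ reading rho p
          else exists d, reading (scons d rho) q
      | Imp q (Imp r Bot) => reading rho q /\ reading rho r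
      | _ => ~ reading rho p
      end
  | Imp p q =>
      match p with
      | Imp r Bot =>
          if encodes_connective r then reading rho p -> reading rho q
          else reading rho r \/ reading rho q
      | _ => reading rho p -> reading rho q
      end
  end.

Lemma reading_not p rho :
  encodes_connective p = false -> reading rho (Imp p Bot) = ~ reading rho p.
Proof.
  destruct p as [| | |a [| | |c [| | | |]|]|[| | |a [| | | |]|]]; try easy.
  intros E; cbn in E |- *; now destruct (refutes_conjunction a).
Qed.

Lemma reading_imp_step p q rho :
  (forall r, p = Imp r Bot -> (reading rho p <-> ~ reading rho r)) -> q <> Bot ->
  reading rho (Imp p q) <-> (reading rho p -> reading rho q).
Proof.
  intros Hp Hq.
  assert (Hor : forall N P Q : Prop, (N <-> ~ P) -> (P \/ Q <-> (N -> Q)))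
    by (intros N P Q; destruct (classic P); tauto).
  destruct p as [| | |r [| | | |]|].
  6: { specialize (Hp r eq_refl); destruct q; try easy.
       all: cbn [reading]; destruct (encodes_connective r);
         [reflexivity|exact (Hor _ _ _ Hp)]. }
  all: destruct q; easy.
Qed.

Lemma reading_neg p rho : reading rho (Imp p Bot) <-> ~ reading rho p.
Proof.
  revert p rho; fix IH 1; intros p rho.
  destruct (encodes_connective p) eqn:E; [|now rewrite reading_not].
  destruct p as [| | |a [| | |c [| | | |]|]|[| | |a [| | | |]|]]; try discriminate E.
  - change (reading rho a /\ reading rho c <-> ~ reading rho (Imp a (Imp c Bot))).
    rewrite reading_imp_step, (IH c rho); [| |easy].
    + split; [tauto|]; intros H; apply NNPP; tauto.
    + intros r Er; destruct a as [| | |r' [| | | |]|]; try discriminate Er.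
      injection Er as <-; apply IH.
  - cbn in E; apply Bool.negb_true_iff in E.
    replace (reading rho (Imp (All (Imp a Bot)) Bot))
      with (exists d, reading (scons d rho) a) by (cbn [reading]; now rewrite E).
    change ((exists d, reading (scons d rho) a) <->
            ~ forall d, reading (scons d rho) (Imp a Bot)).
    split.
    + intros [d H] N; exact (proj1 (IH a _) (N d) H).
    + intros N; apply NNPP; intros H; apply N; intros d; apply IH; eauto.
Qed.

Lemma reading_sat p rho : reading rho p <-> sat mem rho p.
Proof.
  revert rho; induction p as [i j|i j| |p IHp q IHq|p IHp]; intros rho.
  1-3: reflexivity.
  - cbn [sat]; rewrite <- IHp, <- IHq.
    destruct (classic (q = Bot)) as [->|N]; [apply reading_neg|].
    apply reading_imp_step; [|exact N]; intros r ->; apply reading_neg.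
  - split; intros H d; apply IHp, H.
Qed.

End Reading.

(** * Density of a subfield of a complete ordered field *)

Section Density.
Variables (K : Type) (add mul : K -> K -> K) (opp inv : K -> K) (zero one : K).
Variable lt : K -> K -> Prop.

Local Notation "x + y" := (add x y).
Local Notation "x * y" := (mul x y).
Local Notation "x - y" := (add x (opp y)).
Local Notation "x < y" := (lt x y).
Local Notation "x <= y" := (lt x y \/ x = y).
Local Notation "0" := zero.
Local Notation "1" := one.

Hypothesis add_assoc : forall x y z, x + y + z = x + (y + z).
Hypothesis add_comm : forall x y, x + y = y + x.
Hypothesis add_zero : forall x, x + 0 = x.
Hypothesis add_opp : forall x, x - x = 0.
Hypothesis mul_assoc : forall x y z, x * y * z = x * (y * z).
Hypothesis mul_comm : forall x y, x * y = y * x.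
Hypothesis mul_one : forall x, x * 1 = x.
Hypothesis mul_inv : forall x, x <> 0 -> x * inv x = 1.
Hypothesis mul_add : forall x y z, x * (y + z) = x * y + x * z.
Hypothesis zero_ne_one : 0 <> 1.
Hypothesis lt_irrefl : forall x, ~ x < x.
Hypothesis lt_trans : forall x y z, x < y -> y < z -> x < z.
Hypothesis lt_total : forall x y, x < y \/ x = y \/ y < x.
Hypothesis lt_add : forall x y z, x < y -> x + z < y + z.
Hypothesis lt_mul : forall x y, 0 < x -> 0 < y -> 0 < x * y.

Variable Q : K -> Prop.
Hypothesis Q_one : Q 1.
Hypothesis Q_sub : forall x y, Q x -> Q y -> Q (x - y).
Hypothesis Q_div : forall x y, Q x -> Q y -> y <> 0 -> Q (x * inv y).

(** Completeness is required of the two kinds of subsets that the argument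
    uses, because inside a model only definable subsets have suprema. *)
Definition has_sup (S : K -> Prop) : Prop :=
  (exists x, S x) -> (exists b, forall x, S x -> x <= b) ->
  exists m, (forall x, S x -> x <= m) /\
    forall b, (forall x, S x -> x <= b) -> m <= b.
Hypothesis Q_has_sup : has_sup Q.
Hypothesis Q_cut_has_sup : forall b, has_sup (fun q => Q q /\ q <= b).

Lemma field_ring : ring_theory 0 1 add mul (fun x y => x - y) opp eq.
Proof.
  constructor; intros; auto.
  - now rewrite add_comm.
  - now rewrite mul_comm.
  - now rewrite mul_comm, mul_add, (mul_comm z), (mul_comm z).
Qed.
Add Ring field_ring : field_ring.

Lemma lt_iff_sub x y : x < y <-> 0 < y - x.
Proof.
  split; intros H.
  - apply (lt_add _ _ (opp x)) in H; now rewrite add_opp in H.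
  - apply (lt_add _ _ x) in H; replace (0 + x) with x in H by ring.
    now replace (y - x + x) with y in H by ring.
Qed.

Lemma lt_not_le x y : x < y -> ~ y <= x.
Proof. intros H [L| ->]; [|now apply (lt_irrefl x)]. apply (lt_irrefl x); eauto. Qed.

Lemma not_le_lt x y : ~ x <= y -> y < x.
Proof. destruct (lt_total x y) as [|[|]]; tauto. Qed.

Lemma zero_lt_one : 0 < 1.
Proof.
  destruct (lt_total 0 1) as [H|[H|H]]; [exact H|contradiction|].
  apply lt_iff_sub in H.
  replace 1 with ((0 - 1) * (0 - 1)) by ring; now apply lt_mul.
Qed.

Lemma inv_pos x : 0 < x -> 0 < inv x.
Proof.
  intros H.
  assert (E : x * inv x = 1) by (apply mul_inv; intros ->; now apply (lt_irrefl 0)).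
  destruct (lt_total 0 (inv x)) as [L|[L|L]]; [exact L| |].
  - destruct zero_ne_one; rewrite <- E, <- L; ring.
  - apply lt_iff_sub in L; destruct (lt_irrefl 0).
    apply lt_trans with 1; [apply zero_lt_one|].
    apply lt_iff_sub; rewrite <- E.
    replace (0 - x * inv x) with (x * (0 - inv x)) by ring; now apply lt_mul.
Qed.

(** An order-theoretic form of the archimedean property, by completeness: [Q] is
    closed under adding 1, so it has no supremum. *)
Lemma Q_unbounded b : exists q, Q q /\ b < q.
Proof.
  apply NNPP; intros N.
  destruct Q_has_sup as [m [U L]].
  - now exists 1.
  - exists b; intros x Hx; apply NNPP; intros H; apply N; exists x.
    split; [exact Hx|now apply not_le_lt].
  - assert (H : m - 1 < m).
    { apply lt_iff_sub; replace (m - (m - 1)) with 1 by ring; apply zero_lt_one. }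
    apply (lt_not_le _ _ H), L; intros q Hq.
    assert (Q (q + 1)) as [Lq|Eq]%U.
    { replace (q + 1) with (q - ((1 - 1) - 1)) by ring; auto. }
    + left; apply lt_iff_sub; apply lt_iff_sub in Lq.
      now replace (m - 1 - q) with (m - (q + 1)) by ring.
    + right; rewrite <- Eq; ring.
Qed.

Lemma Q_small d : 0 < d -> exists e, Q e /\ 0 < e /\ e < d.
Proof.
  intros H; destruct (Q_unbounded (inv d)) as [q [Hq L]].
  assert (P : 0 < q) by (eapply lt_trans; [apply inv_pos|]; eassumption).
  assert (D : d * inv d = 1) by (apply mul_inv; intros ->; now apply (lt_irrefl 0)).
  assert (N : q <> 0) by (intros ->; now apply (lt_irrefl 0)).
  assert (E := mul_inv _ N).
  exists (inv q); split; [|split; [now apply inv_pos|]].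
  - replace (inv q) with (1 * inv q) by ring; now apply Q_div.
  - apply lt_iff_sub; apply lt_iff_sub in L.
    apply (lt_mul (d * inv q)) in L; [|apply lt_mul; [|apply inv_pos]; assumption].
    replace (d * inv q * (q - inv d)) with (d * (q * inv q) - (d * inv d) * inv q) in L
      by ring.
    rewrite E, D in L.
    now replace (d - inv q) with (d * 1 - 1 * inv q) by ring.
Qed.

(** Below [x], adding a small step [e] to an element of [Q] close to the
    supremum of the elements of [Q] below [x] leads to a point beyond [x]. *)
Theorem Q_dense x y : x < y -> exists q, Q q /\ x < q /\ q < y.
Proof.
  intros H; apply lt_iff_sub in H; destruct (Q_small _ H) as (e & He & Pe & Le).
  assert (Q0 : Q 0) by (rewrite <- (add_opp 1); auto).
  destruct (Q_cut_has_sup x) as [m [U L]].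
  - destruct (Q_unbounded (0 - x)) as [q [Hq Lq]].
    exists (0 - q); split; [auto|left].
    apply lt_iff_sub; apply lt_iff_sub in Lq.
    now replace (x - (0 - q)) with (q - (0 - x)) by ring.
  - exists x; tauto.
  - apply NNPP; intros N.
    assert (Hm : m - e < m).
    { apply lt_iff_sub; now replace (m - (m - e)) with e by ring. }
    apply (lt_not_le _ _ Hm), L; intros q [Hq Lq].
    assert (Qe : Q (q + e)).
    { replace (q + e) with (q - (0 - e)) by ring; auto. }
    assert (q + e <= m) as C.
    { apply U; split; [exact Qe|]; apply NNPP; intros G; apply not_le_lt in G.
      apply N; exists (q + e); split; [exact Qe|split; [exact G|]].
      apply lt_iff_sub; apply lt_iff_sub in Le.
      replace (y - (q + e)) with ((y - x - e) + (x - q)) by ring.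
      destruct Lq as [Lq| ->].
      - apply lt_iff_sub in Lq; apply lt_trans with (y - x - e); [exact Le|].
        apply lt_iff_sub.
        now replace (y - x - e + (x - q) - (y - x - e)) with (x - q) by ring.
      - now replace (y - x - e + (x - x)) with (y - x - e) by ring. }
    destruct C as [C|C].
    + left; apply lt_iff_sub; apply lt_iff_sub in C.
      now replace (m - e - q) with (m - (q + e)) by ring.
    + right; rewrite <- C; ring.
Qed.

End Density.

(** * Sets in a model of ZF *)

(** The notions of the statement, for the elements of a model. Each has the shape
    that [reading] gives to the corresponding formula, so that the two are
    convertible. This explains two spellings: an implication with a negated
    premise appears as a disjunction (in the axiom on inverses and in
    [subfield]), and a disjunction whose first member is an emptiness statement
    appears as an implication (in [is_gtau_n]). *)
Module Sem.
Section Notions.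
Context {M : Type} (mem : M -> M -> Prop).
Local Notation "x ∈ y" := (mem x y) (at level 70).
Local Notation "x ∉ y" := (~ mem x y) (at level 70).

Definition nonempty (a : M) : Prop := exists x, x ∈ a.
Definition subset (a b : M) : Prop := forall x, x ∈ a -> x ∈ b.
Definition disjoint (a b : M) : Prop := forall x, ~ (x ∈ a /\ x ∈ b).
Definition is_diff (c a b : M) : Prop := forall x, x ∈ c <-> x ∈ a /\ x ∉ b.
Definition is_union (u a : M) : Prop :=
  forall x, x ∈ u <-> exists y, y ∈ a /\ x ∈ y.
Definition is_upair (c a b : M) : Prop := forall x, x ∈ c <-> x = a \/ x = b.
Definition is_pair (p a b : M) : Prop :=
  forall c, c ∈ p <-> is_upair c a a \/ is_upair c a b.
Definition is_prod (p a b : M) : Prop :=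
  forall c, c ∈ p <-> exists x y, x ∈ a /\ y ∈ b /\ is_pair c x y.
Definition related (r a b : M) : Prop := exists p, is_pair p a b /\ p ∈ r.
Definition is_fun (f a b : M) : Prop :=
  (forall p, p ∈ f -> exists x y, x ∈ a /\ y ∈ b /\ is_pair p x y) /\
  (forall x, x ∈ a -> exists y, related f x y /\ forall z, related f x z -> z = y).
Definition value2 (f x y z : M) : Prop := exists p, is_pair p x y /\ related f p z.
Definition is_preimage (w f a v : M) : Prop :=
  forall x, x ∈ w <-> x ∈ a /\ exists y, y ∈ v /\ related f x y.
Definition lesseq (lt x y : M) : Prop := related lt x y \/ x = y.

Definition ordered_field (R add mul lt zero one : M) : Prop :=
  (exists P, is_prod P R R /\ is_fun add P R /\ is_fun mul P R /\ subset lt P) /\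
  (zero ∈ R /\ one ∈ R /\ zero <> one) /\
  (forall x y z u v w, x ∈ R -> y ∈ R -> z ∈ R ->
     value2 add x y u -> value2 add u z w -> value2 add y z v ->
     value2 add x v w) /\
  (forall x y z, x ∈ R -> y ∈ R -> value2 add x y z -> value2 add y x z) /\
  (forall x, x ∈ R -> value2 add x zero x) /\
  (forall x, x ∈ R -> exists y, y ∈ R /\ value2 add x y zero) /\
  (forall x y z u v w, x ∈ R -> y ∈ R -> z ∈ R ->
     value2 mul x y u -> value2 mul u z w -> value2 mul y z v ->
     value2 mul x v w) /\
  (forall x y z, x ∈ R -> y ∈ R -> value2 mul x y z -> value2 mul y x z) /\
  (forall x, x ∈ R -> value2 mul x one x) /\
  (forall x, x ∈ R -> x = zero \/ exists y, y ∈ R /\ value2 mul x y one) /\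
  (forall x y z s u v w, x ∈ R -> y ∈ R -> z ∈ R ->
     value2 add y z s -> value2 mul x s w ->
     value2 mul x y u -> value2 mul x z v ->
     value2 add u v w) /\
  (forall x, x ∈ R -> ~ related lt x x) /\
  (forall x y z, x ∈ R -> y ∈ R -> z ∈ R ->
     related lt x y -> related lt y z -> related lt x z) /\
  (forall x y, x ∈ R -> y ∈ R -> related lt x y \/ x = y \/ related lt y x) /\
  (forall x y z u v, x ∈ R -> y ∈ R -> z ∈ R ->
     related lt x y -> value2 add x z u -> value2 add y z v -> related lt u v) /\
  (forall x y z, x ∈ R -> y ∈ R ->
     related lt zero x -> related lt zero y -> value2 mul x y z -> related lt zero z).

Definition upper_bound (lt b s : M) : Prop := forall x, x ∈ s -> lesseq lt x b.

Definition complete_order (R lt : M) : Prop :=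
  forall s, subset s R -> nonempty s ->
    (exists b, b ∈ R /\ upper_bound lt b s) ->
    exists m, m ∈ R /\ upper_bound lt m s /\
      forall b, b ∈ R -> upper_bound lt b s -> lesseq lt m b.

Definition real_field (R add mul lt zero one : M) : Prop :=
  ordered_field R add mul lt zero one /\ complete_order R lt.

Definition subfield (k R add mul zero one : M) : Prop :=
  subset k R /\ one ∈ k /\
  (forall x y z, x ∈ k -> y ∈ k -> z ∈ R -> value2 add z y x -> z ∈ k) /\
  (forall x y z, x ∈ k -> y ∈ k -> z ∈ R ->
     y = zero \/ (value2 mul z y x -> z ∈ k)).

Definition rational_subfield (Q R add mul zero one : M) : Prop :=
  subfield Q R add mul zero one /\
  forall k, subfield k R add mul zero one -> subset Q k.

Definition rational_unit_interval (I Q lt zero one : M) : Prop :=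
  forall r, r ∈ I <-> r ∈ Q /\ related lt zero r /\ related lt r one.

Definition is_gtau_n (N R lt : M) : Prop :=
  forall v, v ∈ N <-> (nonempty v ->
    v = R \/
    (exists a, a ∈ R /\ forall x, x ∈ v <-> x ∈ R /\ related lt x a) \/
    (exists a, a ∈ R /\ forall x, x ∈ v <-> x ∈ R /\ related lt a x) \/
    (exists a b, a ∈ R /\ b ∈ R /\ lesseq lt a b /\
       forall x, x ∈ v <-> x ∈ R /\ (related lt x a \/ related lt b x))).

Definition gen_top (X mu : M) : Prop :=
  (forall u, u ∈ mu -> subset u X) /\
  (forall s, subset s mu -> exists u, is_union u s /\ u ∈ mu).

Definition strong_gen_top (X mu : M) : Prop := gen_top X mu /\ X ∈ mu.

Definition is_closed (X mu a : M) : Prop :=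
  subset a X /\ exists c, is_diff c X a /\ c ∈ mu.

Definition is_closure (X mu c a : M) : Prop :=
  forall x, x ∈ c <-> forall F, is_closed X mu F -> subset a F -> x ∈ F.

Definition continuous (f X mu nu : M) : Prop :=
  forall v, v ∈ nu -> exists w, is_preimage w f X v /\ w ∈ mu.

Definition urysohn_function (X mu R N zero one A B f : M) : Prop :=
  is_fun f X R /\ continuous f X mu N /\
  (forall x, x ∈ A -> related f x zero) /\ (forall x, x ∈ B -> related f x one).

Definition GUL (X mu R N zero one : M) : Prop :=
  forall A B, is_closed X mu A -> is_closed X mu B -> disjoint A B ->
    exists f, urysohn_function X mu R N zero one A B f.

Definition urysohn_family (X mu lt I A B U : M) : Prop :=
  is_fun U I mu /\
  (forall r s Ur Us, r ∈ I -> s ∈ I -> related U r Ur -> related U s Us ->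
     related lt r s -> exists C, is_closure X mu C Ur /\ subset C Us) /\
  (forall r Ur, r ∈ I -> related U r Ur -> subset A Ur) /\
  (forall r Ur, r ∈ I -> related U r Ur ->
     exists C D, is_closure X mu C Ur /\ is_diff D X B /\ subset C D).

Definition characterization : Prop :=
    forall R add mul lt zero one Q I N,
      real_field R add mul lt zero one ->
      rational_subfield Q R add mul zero one ->
      rational_unit_interval I Q lt zero one ->
      is_gtau_n N R lt ->
    forall X mu, strong_gen_top X mu ->
      (GUL X mu R N zero one <->
       forall A B, nonempty A -> nonempty B -> disjoint A B ->
         is_closed X mu A -> is_closed X mu B ->
         exists U, urysohn_family X mu lt I A B U).
End Notions.

End Sem.

(** * Definable predicates and separation *)

Section Model.
Context {M : Type} (mem : M -> M -> Prop).
Hypothesis model_ZF : forall rho p, ZF p -> sat mem rho p.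
Local Notation "x ∈ y" := (mem x y) (at level 70).
Local Notation "x ∉ y" := (~ mem x y) (at level 70).

(** A term is a variable or a parameter from the model. *)
Definition value_of (rho : nat -> M) (t : nat + M) : M :=
  match t with inl i => rho i | inr c => c end.

Definition is_term (f : (nat -> M) -> M) : Prop :=
  exists t, forall rho, f rho = value_of rho t.

(** Attaching a term to each variable of the formula lets the definability of
    a predicate be proved by following its syntax, without listing its
    parameters. *)
Definition definable (P : (nat -> M) -> Prop) : Prop :=
  exists p s, forall rho, P rho <-> sat mem (fun i => value_of rho (s i)) p.

Lemma sat_ren p s rho : sat mem rho (ren s p) <-> sat mem (fun i => rho (s i)) p.
Proof.
  revert s rho; induction p as [i j|i j| |p IHp q IHq|p IHp]; intros s rho; cbn;
    [reflexivity..|now rewrite IHp, IHq|].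
  split; intros H d; specialize (H d); [apply IHp in H|apply IHp];
    replace (fun i => scons d rho (up s i)) with (scons d (fun i => rho (s i))) in *;
    auto; apply functional_extensionality; now intros [|i].
Qed.

Lemma term_var i : is_term (fun rho => rho i).
Proof. now exists (inl i). Qed.

Lemma term_param c : is_term (fun _ => c).
Proof. now exists (inr c). Qed.

Lemma definable_iff P P' :
  (forall rho, P rho <-> P' rho) -> definable P -> definable P'.
Proof.
  intros E [p [s H]]; exists p, s; intros rho; rewrite <- H; symmetry; apply E.
Qed.

Lemma definable_mem f g :
  is_term f -> is_term g -> definable (fun rho => f rho ∈ g rho).
Proof.
  intros [t Ht] [u Hu]; exists (Mem 0 1), (scons t (fun _ => u)); intros rho; cbn.
  now rewrite Ht, Hu.
Qed.

Lemma definable_eq f g :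
  is_term f -> is_term g -> definable (fun rho => f rho = g rho).
Proof.
  intros [t Ht] [u Hu]; exists (Eq 0 1), (scons t (fun _ => u)); intros rho; cbn.
  now rewrite Ht, Hu.
Qed.

Lemma definable_False : definable (fun _ => False).
Proof. now exists Bot, inl. Qed.

(** The variables of the two formulas are made disjoint: even numbers for one,
    odd numbers for the other. *)
Lemma definable_imp P P' :
  definable P -> definable P' -> definable (fun rho => P rho -> P' rho).
Proof.
  intros [p [s H]] [p' [s' H']].
  exists (Imp (ren (fun i => 2 * i) p) (ren (fun i => S (2 * i)) p')).
  exists (fun i => if Nat.even i then s (Nat.div2 i) else s' (Nat.div2 i)).
  intros rho; rewrite H, H'; cbn [sat]; rewrite !sat_ren.
  replace (fun i => value_of rho (if Nat.even (2 * i) then s (Nat.div2 (2 * i)) else _))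
    with (fun i => value_of rho (s i)).
  2: { apply functional_extensionality; intros i.
       now rewrite Nat.even_even, Nat.div2_double. }
  replace (fun i => value_of rho (if Nat.even (S (2 * i)) then _ else _))
    with (fun i => value_of rho (s' i)); [reflexivity|].
  apply functional_extensionality; intros i.
  now rewrite Nat.div2_succ_double, Nat.even_succ, Nat.odd_even.
Qed.

(** Makes the variables standing for the term [inl 0] the variable bound by a
    quantifier. *)
Definition bind (s : nat -> nat + M) (i : nat) : nat :=
  match s i with inl 0 => 0 | _ => S i end.

Lemma value_of_bind s (d : M) rho rho' :
  (forall i t, s i = t -> match t with
                          | inl 0 => True
                          | inl (S j) => rho' i = rho j
                          | inr c => rho' i = c
                          end) ->
  (fun i => value_of (scons d rho) (s i)) = (fun i => scons d rho' (bind s i)).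
Proof.
  intros H; apply functional_extensionality; intros i; unfold bind.
  specialize (H i _ eq_refl); now destruct (s i) as [[|j]|c].
Qed.

Lemma definable_all (P : M -> (nat -> M) -> Prop) :
  definable (fun rho => P (rho 0) (fun i => rho (S i))) ->
  definable (fun rho => forall d, P d rho).
Proof.
  intros [p [s H]].
  exists (All (ren (bind s) p)).
  exists (fun i => match s i with inl (S j) => inl j | t => t end).
  intros rho; cbn [sat].
  assert (E : forall d, P d rho <-> sat mem (fun i => value_of (scons d rho) (s i)) p).
  { intros d; exact (H (scons d rho)). }
  split; intros G d; specialize (G d); [apply E in G; rewrite sat_ren|apply E; rewrite sat_ren in G].
  all: erewrite value_of_bind in *; [eassumption|].
  all: cbn; intros i t ->; now destruct t as [[|j]|c].
Qed.

Lemma definable_not P : definable P -> definable (fun rho => ~ P rho).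
Proof. intros H; apply definable_imp; [exact H|apply definable_False]. Qed.

Lemma definable_or P P' :
  definable P -> definable P' -> definable (fun rho => P rho \/ P' rho).
Proof.
  intros H H'; apply definable_iff with (fun rho => ~ P rho -> P' rho).
  - intros rho; destruct (classic (P rho)); tauto.
  - now apply definable_imp; [apply definable_not|].
Qed.

Lemma definable_and P P' :
  definable P -> definable P' -> definable (fun rho => P rho /\ P' rho).
Proof.
  intros H H'; apply definable_iff with (fun rho => ~ (P rho -> ~ P' rho)).
  - intros rho; destruct (classic (P rho)); destruct (classic (P' rho)); tauto.
  - now apply definable_not, definable_imp; [|apply definable_not].
Qed.

Lemma definable_ex (P : M -> (nat -> M) -> Prop) :
  definable (fun rho => P (rho 0) (fun i => rho (S i))) ->
  definable (fun rho => exists d, P d rho).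
Proof.
  intros H; apply definable_iff with (fun rho => ~ forall d, ~ P d rho).
  - intros rho; split.
    + intros N; apply NNPP; intros E; apply N; intros d Hd; eauto.
    + intros [d Hd] N; exact (N d Hd).
  - apply definable_not, (definable_all (fun d rho => ~ P d rho)).
    now apply (definable_not (fun rho => P (rho 0) (fun i => rho (S i)))).
Qed.

(** A definable predicate is given by a formula with terms attached to its
    variables; [bind] turns it into an instance of the separation schema, and the
    environment supplies the parameters. *)
Lemma separation a (P : M -> Prop) :
  definable (fun rho => P (rho 0)) -> exists b, forall x, x ∈ b <-> x ∈ a /\ P x.
Proof.
  intros [p [s H]].
  (* Only the values of [e] at parameters matter; [a] is a default for variables
     that [P] does not depend on. *)
  pose (e i := value_of (fun _ => a) (s i)).
  set (q := ren (bind s) p).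
  assert (A : exists b, forall x, x ∈ b <->
            x ∈ a /\ sat mem (scons x (scons b (scons a e))) (plug q [2] 3)).
  { apply NNPP; intros N.
    apply (model_ZF e _ (ZF_separation q) a); intros b Hb; apply N.
    exists b; intros x; specialize (Hb x); revert Hb.
    change (~ ((x ∈ b ->
                ~ (x ∈ a -> ~ sat mem (scons x (scons b (scons a e))) (plug q [2] 3))) ->
               ~ (~ (x ∈ a -> ~ sat mem (scons x (scons b (scons a e))) (plug q [2] 3)) ->
                x ∈ b)) ->
            (x ∈ b <->
             x ∈ a /\ sat mem (scons x (scons b (scons a e))) (plug q [2] 3))).
    tauto. }
  destruct A as [b Hb]; exists b; intros x; rewrite Hb; clear Hb.
  assert (E : P x <-> sat mem (fun i => value_of (scons x (fun _ => a)) (s i)) p)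
    by exact (H (scons x (fun _ => a))).
  rewrite value_of_bind with (rho' := e) in E.
  2: { intros i [[|j]|c] Es; unfold e; now rewrite ?Es. }
  rewrite E; unfold plug, q; rewrite !sat_ren.
  replace (fun i => scons x e (bind s i)) with (fun i => scons x (scons b (scons a e))
    match nth_error [2] (bind s i) with
    | Some y => 3 - S y
    | None => 3 + (bind s i - length [2])
    end); [reflexivity|].
  apply functional_extensionality; intros i; destruct (bind s i) as [|j]; [reflexivity|].
  cbn; now rewrite nth_error_nil, Nat.sub_0_r.
Qed.

(** The reading of a closed axiom computes, so the set-theoretic axioms that
    follow are obtained by conversion. *)
Lemma model_axiom (d : M) (p : form) : ZF p -> reading mem (fun _ => d) p.
Proof. intros H; now apply reading_sat, model_ZF. Qed.

Lemma extensionality a b : (forall x, x ∈ a <-> x ∈ b) -> a = b.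
Proof. exact (model_axiom a _ ZF_ext a b). Qed.

Lemma pairing a b : exists c, Sem.is_upair mem c a b.
Proof. exact (model_axiom a _ ZF_pairing a b). Qed.

Lemma union a : exists u, Sem.is_union mem u a.
Proof. exact (model_axiom a _ ZF_union a). Qed.

Lemma power a : exists p, forall x, x ∈ p <-> Sem.subset mem x a.
Proof. exact (model_axiom a _ ZF_power a). Qed.

Ltac definable :=
  cbv beta delta [Sem.nonempty Sem.subset Sem.disjoint Sem.is_diff Sem.is_union
    Sem.is_upair Sem.is_pair Sem.related Sem.lesseq Sem.is_closed iff];
  repeat (first
    [ assumption
    | apply definable_mem | apply definable_eq
    | apply definable_and | apply definable_or | apply definable_not
    | apply definable_imp | apply definable_all | apply definable_ex
    | apply definable_False | apply term_param | apply term_var ];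
    cbv beta).

Local Notation subset := (Sem.subset mem).
Local Notation nonempty := (Sem.nonempty mem).
Local Notation disjoint := (Sem.disjoint mem).
Local Notation is_diff := (Sem.is_diff mem).
Local Notation is_union := (Sem.is_union mem).
Local Notation is_upair := (Sem.is_upair mem).
Local Notation is_pair := (Sem.is_pair mem).
Local Notation is_prod := (Sem.is_prod mem).
Local Notation related := (Sem.related mem).
Local Notation is_fun := (Sem.is_fun mem).
Local Notation value2 := (Sem.value2 mem).
Local Notation is_closed := (Sem.is_closed mem).
Local Notation is_closure := (Sem.is_closure mem).
Local Notation lesseq := (Sem.lesseq mem).

Lemma difference a b : exists c, is_diff c a b.
Proof. apply separation; definable. Qed.

Lemma is_upair_unique c d a b : is_upair c a b -> is_upair d a b -> c = d.
Proof. intros H H'; apply extensionality; intros x; rewrite (H x), (H' x); tauto. Qed.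

Lemma is_pair_unique p q a b : is_pair p a b -> is_pair q a b -> p = q.
Proof. intros H H'; apply extensionality; intros x; rewrite (H x), (H' x); tauto. Qed.

Lemma pair_exists a b : exists p, is_pair p a b.
Proof.
  destruct (pairing a a) as [c Hc], (pairing a b) as [d Hd], (pairing c d) as [p Hp].
  exists p; intros x; rewrite (Hp x); split; intros [H|H]; subst; auto.
  - left; eapply is_upair_unique; eauto.
  - right; eapply is_upair_unique; eauto.
Qed.

Lemma is_pair_inj p a b a' b' : is_pair p a b -> is_pair p a' b' -> a = a' /\ b = b'.
Proof.
  intros H H'.
  (* By symmetry it is enough that [b] is [a'] or [b']. *)
  assert (S : forall a b a' b', is_pair p a b -> is_pair p a' b' ->
              a = a' /\ (b = a' \/ b = b')).
  { clear - model_ZF; intros a b a' b' H H'.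
    destruct (pairing a a) as [c Hc], (pairing a b) as [d Hd].
    assert (In_c : a ∈ c) by (apply Hc; auto).
    assert (In_d : b ∈ d) by (apply Hd; auto).
    assert (Pc : c ∈ p) by (apply H; auto); apply H' in Pc.
    assert (Pd : d ∈ p) by (apply H; auto); apply H' in Pd.
    split.
    - destruct Pc as [E|E].
      + now apply E in In_c as [?|?].
      + symmetry; assert (a' ∈ c) as [?|?]%Hc by (apply E; auto); auto.
    - destruct Pd as [E|E]; apply E in In_d; tauto. }
  destruct (S _ _ _ _ H H') as [-> E], (S _ _ _ _ H' H) as [_ E'].
  split; [reflexivity|]; destruct E, E'; congruence.
Qed.

Lemma related_pair r a b p : is_pair p a b -> related r a b <-> p ∈ r.
Proof.
  intros H; split; [|now exists p].
  intros [q [Hq Hr]]; now rewrite (is_pair_unique _ _ _ _ H Hq).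
Qed.

Lemma fun_dom_cod f a b x y : is_fun f a b -> related f x y -> x ∈ a /\ y ∈ b.
Proof.
  intros [H _] [p [Hp Hf]]; destruct (H p Hf) as (x' & y' & Hx & Hy & Hp').
  now destruct (is_pair_inj _ _ _ _ _ Hp Hp') as [-> ->].
Qed.

Lemma fun_unique f a b x y z :
  is_fun f a b -> related f x y -> related f x z -> y = z.
Proof.
  intros Hf Hy Hz; destruct (fun_dom_cod _ _ _ _ _ Hf Hy) as [Hx _].
  destruct Hf as [_ H]; destruct (H x Hx) as (w & _ & U).
  now rewrite (U y Hy), (U z Hz).
Qed.

(** The graph is cut out of the second power set of [a ∪ b], which contains all
    pairs from [a] and [b]. *)
Lemma function_exists a b (P : M -> M -> Prop) :
  definable (fun rho => P (rho 1) (rho 0)) ->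
  (forall x, x ∈ a -> exists y, y ∈ b /\ P x y /\ forall z, z ∈ b -> P x z -> z = y) ->
  exists f, is_fun f a b /\ forall x y, x ∈ a -> (related f x y <-> y ∈ b /\ P x y).
Proof.
  intros D H.
  destruct (pairing a b) as [ab Hab], (union ab) as [u Hu], (power u) as [pu Hpu],
    (power pu) as [ppu Hppu].
  destruct (separation ppu
    (fun p => exists x y, x ∈ a /\ y ∈ b /\ P x y /\ is_pair p x y)) as [f Hf].
  { definable. }
  assert (F : forall p, p ∈ f <->
            exists x y, x ∈ a /\ y ∈ b /\ P x y /\ is_pair p x y).
  { intros p; rewrite Hf; split; [tauto|]; intros E; split; [|exact E].
    destruct E as (x & y & Hx & Hy & _ & Hp).
    apply Hppu; intros c Hc; apply Hpu; intros z Hz; apply Hu.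
    apply Hp in Hc as [Hc|Hc]; apply Hc in Hz as [-> | ->];
      [exists a|exists a|exists a|exists b]; rewrite (Hab _); auto. }
  assert (G : forall x y, x ∈ a -> (related f x y <-> y ∈ b /\ P x y)).
  { intros x y Hx; destruct (pair_exists x y) as [p Hp].
    rewrite (related_pair _ _ _ _ Hp), F; split.
    - intros (x' & y' & _ & Hy & HP & Hp').
      now destruct (is_pair_inj _ _ _ _ _ Hp Hp') as [-> ->].
    - intros [Hy HP]; now exists x, y. }
  exists f; split; [split|exact G].
  - intros p Hp; apply F in Hp as (x & y & Hx & Hy & _ & Hp); now exists x, y.
  - intros x Hx; destruct (H x Hx) as (y & Hy & HP & U).
    exists y; split; [now apply G|]; intros z Hz; apply G in Hz; [|exact Hx].
    now apply U.
Qed.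

(** * The rationals of the model *)

Section RealField.
Variables R add mul lt zero one Q : M.
Hypothesis HR : Sem.real_field mem R add mul lt zero one.
Hypothesis HQ : Sem.rational_subfield mem Q R add mul zero one.

Definition R_type : Type := {x : M | x ∈ R}.

Lemma R_type_eq (x y : R_type) : proj1_sig x = proj1_sig y -> x = y.
Proof. intros E; apply eq_sig_hprop; [intros; apply proof_irrelevance|exact E]. Qed.

Lemma operation_value op P :
  is_prod P R R -> is_fun op P R ->
  exists g : R_type -> R_type -> R_type,
    forall x y z, value2 op (proj1_sig x) (proj1_sig y) z <-> z = proj1_sig (g x y).
Proof.
  intros HP Hop.
  assert (E : forall x y : R_type, exists z : R_type,
     forall w, value2 op (proj1_sig x) (proj1_sig y) w <-> w = proj1_sig z).
  { intros [x Hx] [y Hy]; cbn; destruct (pair_exists x y) as [p Hp].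
    assert (pP : p ∈ P) by (apply HP; now exists x, y).
    destruct (proj2 Hop p pP) as (z & Hz & U).
    destruct (fun_dom_cod _ _ _ _ _ Hop Hz) as [_ HzR].
    exists (exist _ z HzR); cbn; intros w; split.
    - intros [q [Hq Hw]]; apply U; now rewrite (is_pair_unique _ _ _ _ Hp Hq).
    - intros ->; now exists p. }
  exists (fun x y => proj1_sig (constructive_indefinite_description _ (E x y))).
  intros x y; exact (proj2_sig (constructive_indefinite_description _ (E x y))).
Qed.

(** The relational arithmetic of the model is turned into functions on the type
    of its reals, where [Q_dense] applies. *)
Theorem rationals_dense :
  related lt zero one /\
  forall x y, x ∈ R -> y ∈ R -> related lt x y ->
    exists q, q ∈ Q /\ related lt x q /\ related lt q y.
Proof.
  destruct HR as [((P & HP & Hadd & Hmul & _) & (H0 & H1 & H01) & addA & addC & add0 &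
    addN & mulA & mulC & mul1 & mulV & mulD & ltI & ltT & ltC & ltD & ltM) comp].
  destruct HQ as [(QR & Q1 & Qsub & Qdiv) _]; clear HR HQ.
  destruct (operation_value _ _ HP Hadd) as [Add A].
  destruct (operation_value _ _ HP Hmul) as [Mul B].
  pose (Zero := exist _ zero H0 : R_type); pose (One := exist _ one H1 : R_type).
  pose (Lt (x y : R_type) := related lt (proj1_sig x) (proj1_sig y)).
  assert (A' : forall x y, value2 add (proj1_sig x) (proj1_sig y) (proj1_sig (Add x y)))
    by (intros x y; now apply A).
  assert (B' : forall x y, value2 mul (proj1_sig x) (proj1_sig y) (proj1_sig (Mul x y)))
    by (intros x y; now apply B).
  assert (N : forall x, exists y, Add x y = Zero).
  { intros [x Hx]; destruct (addN x Hx) as [y [Hy E]].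
    exists (exist _ y Hy); apply R_type_eq; symmetry; now apply A. }
  assert (V : forall x, exists y, x <> Zero -> Mul x y = One).
  { intros [x Hx]; destruct (mulV x Hx) as [->|[y [Hy E]]].
    - exists Zero; intros H; destruct H; now apply R_type_eq.
    - exists (exist _ y Hy); intros _; apply R_type_eq; symmetry; now apply B. }
  pose (Opp x := proj1_sig (constructive_indefinite_description _ (N x))).
  pose (Inv x := proj1_sig (constructive_indefinite_description _ (V x))).
  assert (addN' : forall x, Add x (Opp x) = Zero)
    by (intros x; exact (proj2_sig (constructive_indefinite_description _ (N x)))).
  assert (mulV' : forall x, x <> Zero -> Mul x (Inv x) = One)
    by (intros x; exact (proj2_sig (constructive_indefinite_description _ (V x)))).
  clearbody Opp Inv; clear N V addN mulV.
  assert (addA' : forall x y z, Add (Add x y) z = Add x (Add y z)).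
  { intros x y z; apply R_type_eq, A.
    eapply addA; [apply (proj2_sig x)|apply (proj2_sig y)|apply (proj2_sig z)|..];
      apply A'. }
  assert (addC' : forall x y, Add x y = Add y x).
  { intros x y; apply R_type_eq, A, addC; try apply proj2_sig; apply A'. }
  assert (add0' : forall x, Add x Zero = x).
  { intros x; apply R_type_eq; symmetry; apply A, add0, proj2_sig. }
  assert (mulA' : forall x y z, Mul (Mul x y) z = Mul x (Mul y z)).
  { intros x y z; apply R_type_eq, B.
    eapply mulA; [apply (proj2_sig x)|apply (proj2_sig y)|apply (proj2_sig z)|..];
      apply B'. }
  assert (mulC' : forall x y, Mul x y = Mul y x).
  { intros x y; apply R_type_eq, B, mulC; try apply proj2_sig; apply B'. }
  assert (mul1' : forall x, Mul x One = x).
  { intros x; apply R_type_eq; symmetry; apply B, mul1, proj2_sig. }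
  assert (mulD' : forall x y z, Mul x (Add y z) = Add (Mul x y) (Mul x z)).
  { intros x y z; apply R_type_eq, A.
    eapply mulD; [apply (proj2_sig x)|apply (proj2_sig y)|apply (proj2_sig z)|..];
      [apply A'|apply B'..]. }
  assert (H01' : Zero <> One) by (intros E; apply H01, (f_equal (@proj1_sig _ _) E)).
  assert (ltI' : forall x, ~ Lt x x) by (intros x; apply ltI, proj2_sig).
  assert (ltT' : forall x y z, Lt x y -> Lt y z -> Lt x z)
    by (intros x y z; apply ltT; apply proj2_sig).
  assert (ltC' : forall x y, Lt x y \/ x = y \/ Lt y x).
  { intros x y; destruct (ltC _ _ (proj2_sig x) (proj2_sig y)) as [|[|]]; auto.
    right; left; now apply R_type_eq. }
  assert (ltD' : forall x y z, Lt x y -> Lt (Add x z) (Add y z)).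
  { intros x y z H; eapply ltD; [apply (proj2_sig x)|apply (proj2_sig y)|
      apply (proj2_sig z)|exact H|apply A'..]. }
  assert (ltM' : forall x y, Lt Zero x -> Lt Zero y -> Lt Zero (Mul x y)).
  { intros x y Hx Hy; eapply ltM; [apply (proj2_sig x)|apply (proj2_sig y)|
      exact Hx|exact Hy|apply B']. }
  pose (Rat (x : R_type) := proj1_sig x ∈ Q).
  assert (Qsub' : forall x y, Rat x -> Rat y -> Rat (Add x (Opp y))).
  { intros x y Hx Hy; apply (Qsub _ _ _ Hx Hy); [apply proj2_sig|].
    apply A; now rewrite addA', (addC' (Opp y)), addN', add0'. }
  assert (Qdiv' : forall x y, Rat x -> Rat y -> y <> Zero -> Rat (Mul x (Inv y))).
  { intros x y Hx Hy Ny.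
    destruct (Qdiv _ _ (proj1_sig (Mul x (Inv y))) Hx Hy (proj2_sig (Mul x (Inv y)))) as [E|E].
    - destruct Ny; now apply R_type_eq.
    - apply E, B; now rewrite mulA', (mulC' (Inv y)), mulV', mul1'. }
  assert (le_iff : forall x y : R_type,
            lesseq lt (proj1_sig x) (proj1_sig y) <-> Lt x y \/ x = y).
  { intros x y; unfold lesseq; split; intros [H|H]; auto.
    - right; now apply R_type_eq.
    - right; now rewrite H. }
  (* Suprema of sets of the model are suprema in the type of its reals. *)
  assert (sup : forall S, subset S R ->
            has_sup R_type Lt (fun x => proj1_sig x ∈ S)).
  { intros S HS [x Hx] [b Hb].
    destruct (comp S HS) as (m & Hm & U & L).
    - now exists (proj1_sig x).
    - exists (proj1_sig b); split; [apply proj2_sig|].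
      intros y Hy; pose (z := exist _ y (HS y Hy) : R_type).
      exact (proj2 (le_iff z b) (Hb z Hy)).
    - exists (exist _ m Hm); split.
      + intros y Hy; apply le_iff, U, Hy.
      + intros c Hc; apply le_iff, L; [apply proj2_sig|].
        intros y Hy; pose (z := exist _ y (HS y Hy) : R_type).
        exact (proj2 (le_iff z c) (Hc z Hy)). }
  assert (supQ : has_sup R_type Lt Rat) by exact (sup Q QR).
  assert (supQle : forall b, has_sup R_type Lt (fun q => Rat q /\ (Lt q b \/ q = b))).
  { intros b; destruct (separation Q (fun q => lesseq lt q (proj1_sig b))) as [S HS].
    { definable. }
    replace (fun q => Rat q /\ (Lt q b \/ q = b)) with (fun q : R_type => proj1_sig q ∈ S).
    - apply sup; intros q Hq; now apply HS, proj1, QR in Hq.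
    - apply functional_extensionality; intros q; apply propositional_extensionality.
      now rewrite HS, le_iff. }
  split.
  - now apply (zero_lt_one R_type Add Mul Opp Zero One Lt).
  - intros x y Hx Hy Hxy.
    destruct (Q_dense R_type Add Mul Opp Inv Zero One Lt) with
      (Q := Rat) (x := exist _ x Hx : R_type) (y := exist _ y Hy : R_type)
      as (q & Hq & L1 & L2); try assumption.
    now exists (proj1_sig q).
Qed.

End RealField.

(** * Closures and continuous functions *)

Section Topology.
Variables X mu : M.
Hypothesis HX : Sem.strong_gen_top mem X mu.

Lemma open_subset u : u ∈ mu -> subset u X.
Proof. apply HX. Qed.

Lemma open_union (P : M -> Prop) :
  definable (fun rho => P (rho 0)) ->
  exists u, u ∈ mu /\ forall x, x ∈ u <-> exists w, w ∈ mu /\ P w /\ x ∈ w.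
Proof.
  intros D; destruct (separation mu P D) as [s Hs].
  destruct (proj2 (proj1 HX) s) as [u [Hu Mu]].
  - intros w Hw; now apply Hs in Hw.
  - exists u; split; [exact Mu|]; intros x; rewrite (Hu x).
    split; intros [w Hw]; exists w; rewrite Hs in *; tauto.
Qed.

Lemma open_union2 u v :
  u ∈ mu -> v ∈ mu -> exists w, w ∈ mu /\ forall x, x ∈ w <-> x ∈ u \/ x ∈ v.
Proof.
  intros Hu Hv.
  destruct (open_union (fun w => w = u \/ w = v)) as [w [Mw Hw]]; [definable|].
  exists w; split; [exact Mw|]; intros x; rewrite Hw; split.
  - intros (t & _ & [-> | ->] & Ht); auto.
  - intros [H|H]; [exists u|exists v]; auto.
Qed.

Lemma open_empty : exists e, e ∈ mu /\ forall x, x ∉ e.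
Proof.
  destruct (open_union (fun _ => False)) as [e [Me He]]; [definable|].
  exists e; split; [exact Me|]; intros x Hx; apply He in Hx as (w & _ & [] & _).
Qed.

Lemma complement_closed o F : o ∈ mu -> is_diff F X o -> is_closed X mu F.
Proof.
  intros Ho HF; split; [intros x Hx; now apply HF in Hx|].
  exists o; split; [|exact Ho]; intros x; rewrite (HF x).
  assert (x ∈ o -> x ∈ X) by apply open_subset, Ho.
  destruct (classic (x ∈ o)); tauto.
Qed.

Lemma closure_exists a : subset a X -> exists c, is_closure X mu c a.
Proof.
  intros Ha.
  destruct (separation X (fun x => forall F, is_closed X mu F -> subset a F -> x ∈ F))
    as [c Hc]; [definable|].
  exists c; intros x; rewrite Hc; split; [tauto|]; intros H; split; [|exact H].
  destruct open_empty as [e [Me He]].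
  apply H; [|exact Ha]; apply (complement_closed e); [exact Me|].
  intros y; specialize (He y); tauto.
Qed.

Lemma subset_closure c a : is_closure X mu c a -> subset a c.
Proof. intros Hc x Hx; apply Hc; auto. Qed.

(** The complement of a closure is the union of the open sets missing [a]. *)
Lemma not_in_closure c a x :
  is_closure X mu c a -> x ∈ X -> x ∉ c ->
  exists o, o ∈ mu /\ x ∈ o /\ forall z, z ∈ o -> z ∉ a.
Proof.
  intros Hc Hx N; apply NNPP; intros G; apply N, Hc.
  intros F [HF [o [Ho Mo]]] Ha; apply NNPP; intros NF; apply G.
  exists o; split; [exact Mo|split; [now apply Ho|]].
  intros z Hz Hza; apply Ho in Hz; now apply Hz, Ha.
Qed.

Lemma closure_misses_open c a o x :
  is_closure X mu c a -> o ∈ mu -> subset a X -> (forall z, z ∈ o -> z ∉ a) ->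
  x ∈ c -> x ∈ X /\ x ∉ o.
Proof.
  intros Hc Ho Ha Hoa Hx; destruct (difference X o) as [F HF].
  apply HF; apply Hc; [exact Hx|now apply (complement_closed o)|].
  intros y Hy; apply HF; split; [now apply Ha|]; intros Hyo; now apply (Hoa y).
Qed.

(** The real line enters through its order, total and complete, with the index
    set [I] dense between zero and one. *)
Section Urysohn.
Variables R lt zero one I N : M.
Hypothesis zero_R : zero ∈ R.
Hypothesis one_R : one ∈ R.
Hypothesis zero_one : related lt zero one.
Hypothesis lt_irrefl_R : forall x, x ∈ R -> ~ related lt x x.
Hypothesis lt_trans_R : forall x y z, x ∈ R -> y ∈ R -> z ∈ R ->
  related lt x y -> related lt y z -> related lt x z.
Hypothesis lt_total_R : forall x y, x ∈ R -> y ∈ R ->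
  related lt x y \/ x = y \/ related lt y x.
Hypothesis R_complete : Sem.complete_order mem R lt.
Hypothesis I_bounds : forall r, r ∈ I -> r ∈ R /\ related lt zero r /\ related lt r one.
Hypothesis I_dense : forall x y, x ∈ R -> y ∈ R ->
  lesseq lt zero x -> related lt x y -> lesseq lt y one ->
  exists r, r ∈ I /\ related lt x r /\ related lt r y.
Hypothesis N_gtau : Sem.is_gtau_n mem N R lt.

Lemma lower_ray a : a ∈ R ->
  exists v, v ∈ N /\ forall x, x ∈ v <-> x ∈ R /\ related lt x a.
Proof.
  intros Ha; destruct (separation R (fun x => related lt x a)) as [v Hv]; [definable|].
  exists v; split; [|exact Hv]; apply N_gtau; intros _; right; left; eauto.
Qed.

Lemma upper_ray a : a ∈ R ->
  exists v, v ∈ N /\ forall x, x ∈ v <-> x ∈ R /\ related lt a x.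
Proof.
  intros Ha; destruct (separation R (fun x => related lt a x)) as [v Hv]; [definable|].
  exists v; split; [|exact Hv]; apply N_gtau; intros _; right; right; left; eauto.
Qed.

(** The nonempty proper open sets of reals are rays and unions of two rays, and
    open sets of the space are closed under unions. *)
Lemma continuous_of_rays f :
  is_fun f X R ->
  (forall a, a ∈ R -> exists w, w ∈ mu /\
     forall x, x ∈ w <-> exists y, related f x y /\ related lt y a) ->
  (forall a, a ∈ R -> exists w, w ∈ mu /\
     forall x, x ∈ w <-> exists y, related f x y /\ related lt a y) ->
  Sem.continuous mem f X mu N.
Proof.
  intros Hf Lo Up.
  assert (C : forall v w, w ∈ mu ->
    (forall x, x ∈ w <-> exists y, y ∈ v /\ related f x y) ->
    exists w, Sem.is_preimage mem w f X v /\ w ∈ mu).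
  { intros v w Mw E; exists w; split; [|exact Mw]; intros x; rewrite E.
    split; [|tauto]; intros (y & Hv & Hy); split; [|now exists y].
    now apply (fun_dom_cod _ _ _ _ _ Hf) in Hy. }
  intros v Hv; destruct (classic (nonempty v)) as [NE|NE].
  - destruct (proj1 (N_gtau v) Hv NE) as
      [-> | [(a & Ha & E) | [(a & Ha & E) | (a & b & Ha & Hb & _ & E)]]].
    + apply (C _ X); [apply HX|]; intros x; split.
      * intros Hx; destruct (proj2 Hf x Hx) as (y & Hy & _).
        exists y; split; [|exact Hy]; now apply (fun_dom_cod _ _ _ _ _ Hf) in Hy.
      * intros (y & _ & Hy); now apply (fun_dom_cod _ _ _ _ _ Hf) in Hy.
    + destruct (Lo a Ha) as (w & Mw & Hw); apply (C _ w Mw); intros x; rewrite Hw.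
      split; intros (y & H); exists y; rewrite E in *; [|tauto].
      destruct H as [Hy L]; repeat split; trivial.
      now apply (fun_dom_cod _ _ _ _ _ Hf) in Hy.
    + destruct (Up a Ha) as (w & Mw & Hw); apply (C _ w Mw); intros x; rewrite Hw.
      split; intros (y & H); exists y; rewrite E in *; [|tauto].
      destruct H as [Hy L]; repeat split; trivial.
      now apply (fun_dom_cod _ _ _ _ _ Hf) in Hy.
    + destruct (Lo a Ha) as (w & Mw & Hw), (Up b Hb) as (w' & Mw' & Hw').
      destruct (open_union2 w w' Mw Mw') as (u & Mu & Hu).
      apply (C _ u Mu); intros x; rewrite Hu, Hw, Hw'; split.
      * intros [(y & Hy & L)|(y & Hy & L)]; exists y; rewrite E;
          repeat split; auto; now apply (fun_dom_cod _ _ _ _ _ Hf) in Hy.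
      * intros (y & H & Hy); apply E in H as [_ [L|L]]; [left|right]; eauto.
  - destruct open_empty as (e & Me & He); apply (C _ e Me); intros x; split.
    + intros H; now apply He in H.
    + intros (y & H & _); destruct NE; now exists y.
Qed.

Lemma constant_function c : c ∈ R ->
  exists f, is_fun f X R /\ Sem.continuous mem f X mu N /\
    forall x, x ∈ X -> related f x c.
Proof.
  intros Hc; destruct (function_exists X R (fun _ y => y = c)) as (f & Hf & V).
  { definable. }
  { intros x _; exists c; auto. }
  exists f; split; [exact Hf|split].
  - assert (W : forall P : M -> Prop, exists w, w ∈ mu /\
              forall x, x ∈ w <-> exists y, related f x y /\ P y).
    { intros P; destruct open_empty as (e & Me & He).
      assert (E : forall x y, related f x y <-> x ∈ X /\ y = c).
      { intros x y; split.
        - intros H; destruct (fun_dom_cod _ _ _ _ _ Hf H) as [Hx _].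
          now apply V in H.
        - intros [Hx ->]; now apply V. }
      destruct (classic (P c)) as [Pc|Pc]; [exists X|exists e].
      - split; [apply HX|]; intros x; split.
        + intros Hx; exists c; now rewrite E.
        + intros (y & Hy & _); now apply E in Hy.
      - split; [exact Me|]; intros x; split; [intros H; now apply He in H|].
        intros (y & Hy & Py); apply E in Hy as [_ ->]; contradiction. }
    apply continuous_of_rays; [exact Hf| |]; intros a _; apply W.
  - intros x Hx; now apply V.
Qed.

(** * From a function to a family *)

(** [U_r] is the preimage of the ray below [r]; its closure lies in the set
    where the function is at most [r], which is closed. *)
Lemma family_of_function A B f :
  subset A X -> Sem.urysohn_function mem X mu R N zero one A B f ->
  exists U, Sem.urysohn_family mem X mu lt I A B U.
Proof.
  intros AX (Hf & Cf & fA & fB).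
  pose (below r w := forall x, x ∈ w <-> exists y, related f x y /\ related lt y r).
  destruct (function_exists I mu below) as (U & HU & V).
  { unfold below; definable. }
  { intros r Hr; destruct (I_bounds r Hr) as [Rr _].
    destruct (lower_ray r Rr) as (v & Nv & Hv), (Cf v Nv) as (w & Hw & Mw).
    exists w; split; [exact Mw|].
    assert (W : below r w).
    { intros x; rewrite (Hw x); split.
      - intros (_ & y & Hy & Hxy); apply Hv in Hy; now exists y.
      - intros (y & Hy & L); destruct (fun_dom_cod _ _ _ _ _ Hf Hy) as [Hx Ry].
        split; [exact Hx|]; exists y; split; [now apply Hv|exact Hy]. }
    split; [exact W|]; intros z _ Hz; apply extensionality; intros x.
    now rewrite (W x), (Hz x). }
  assert (VU : forall r w, r ∈ I -> related U r w -> w ∈ mu /\ below r w)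
    by (intros r w Hr; now apply V).
  assert (CL : forall r w, r ∈ I -> related U r w -> exists c,
            is_closure X mu c w /\ forall x, x ∈ c -> exists y, x ∈ X /\
              related f x y /\ y ∈ R /\ lesseq lt y r).
  { intros r w Hr H; destruct (VU r w Hr H) as [Mw W].
    assert (WX : subset w X) by apply open_subset, Mw.
    destruct (closure_exists w WX) as [c Hc]; exists c; split; [exact Hc|].
    intros x Hx; destruct (I_bounds r Hr) as [Rr _].
    destruct (upper_ray r Rr) as (v & Nv & Hv), (Cf v Nv) as (o & Ho & Mo).
    destruct (closure_misses_open c w o x) as [Xx No]; try assumption.
    { intros z Hz Hzw; apply W in Hzw as (y & Hy & L).
      destruct (fun_dom_cod _ _ _ _ _ Hf Hy) as [_ Ry].
      apply Ho in Hz as (_ & y' & Hy' & Hzy'); apply Hv in Hy' as [_ L'].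
      rewrite (fun_unique _ _ _ _ _ _ Hf Hzy' Hy) in L'.
      apply (lt_irrefl_R r Rr); eauto. }
    destruct (proj2 Hf x Xx) as (y & Hy & _).
    destruct (fun_dom_cod _ _ _ _ _ Hf Hy) as [_ Ry].
    exists y; repeat split; trivial.
    destruct (lt_total_R y r Ry Rr) as [L|[E|L]]; [now left|now right|].
    destruct No; apply Ho; split; [exact Xx|]; exists y; split; [now apply Hv|exact Hy]. }
  exists U; split; [exact HU|split; [|split]].
  - intros r s Ur Us Hr Hs Hur Hus L; destruct (CL r Ur Hr Hur) as (c & Hc & K).
    exists c; split; [exact Hc|]; intros x Hx; destruct (K x Hx) as (y & Xx & Hy & Ry & Ly).
    apply (VU s Us Hs Hus); exists y; split; [exact Hy|].
    destruct Ly as [Ly| ->]; [|exact L].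
    apply lt_trans_R with r; trivial; now apply I_bounds.
  - intros r Ur Hr Hur x Hx; apply (VU r Ur Hr Hur); exists zero.
    split; [now apply fA|now apply I_bounds].
  - intros r Ur Hr Hur; destruct (CL r Ur Hr Hur) as (c & Hc & K).
    destruct (difference X B) as [D HD]; exists c, D; split; [exact Hc|split; [exact HD|]].
    intros x Hx; destruct (K x Hx) as (y & Xx & Hy & Ry & Ly).
    apply HD; split; [exact Xx|]; intros Bx.
    rewrite (fun_unique _ _ _ _ _ _ Hf Hy (fB x Bx)) in Ly.
    destruct (I_bounds r Hr) as (Rr & _ & L1); apply (lt_irrefl_R r Rr).
    destruct Ly as [Ly| <-]; [now apply lt_trans_R with one|exact L1].
Qed.

(** * From a family to a function *)

Section FunctionOfFamily.
Variables A B U : M.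
Hypothesis AX : subset A X.
Hypothesis BX : subset B X.
Hypothesis HU : Sem.urysohn_family mem X mu lt I A B U.

Definition inside (r x : M) : Prop := exists w, related U r w /\ x ∈ w.

Lemma family_value r : r ∈ I -> exists w, related U r w /\ w ∈ mu /\
  forall x, inside r x <-> x ∈ w.
Proof.
  intros Hr; destruct HU as (Uf & _).
  destruct (proj2 Uf r Hr) as (w & Hw & E); exists w; split; [exact Hw|split].
  - now apply (fun_dom_cod _ _ _ _ _ Uf) in Hw.
  - intros x; split; [intros (w' & Hw' & Hx); now rewrite <- (E w' Hw')|].
    intros Hx; now exists w.
Qed.

(** A point outside [U_s] is outside the closure of [U_r], hence has an open set
    around it that misses [U_r]. *)
Lemma outside_open r s x :
  r ∈ I -> s ∈ I -> related lt r s -> x ∈ X -> ~ inside s x ->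
  exists o, o ∈ mu /\ x ∈ o /\ forall z, z ∈ o -> ~ inside r z.
Proof.
  intros Hr Hs L Hx N1.
  destruct (family_value r Hr) as (w & Uw & Mw & Ew).
  destruct (family_value s Hs) as (w' & Uw' & Mw' & Ew').
  destruct (proj1 (proj2 HU) r s w w' Hr Hs Uw Uw' L) as (c & Hc & Sc).
  destruct (not_in_closure c w x Hc Hx) as (o & Mo & Ho & D).
  - intros Cx; apply N1, Ew'; now apply Sc.
  - exists o; repeat split; trivial; intros z Hz H; apply (D z Hz); now apply Ew.
Qed.

Lemma inside_mono r s x :
  r ∈ I -> s ∈ I -> related lt r s -> inside r x -> inside s x.
Proof.
  intros Hr Hs L H; apply NNPP; intros N1.
  assert (Hx : x ∈ X).
  { destruct (family_value r Hr) as (w & _ & Mw & Ew).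
    apply (open_subset w Mw); now apply Ew. }
  destruct (outside_open r s x Hr Hs L Hx N1) as (o & _ & Ho & D).
  now apply (D x Ho).
Qed.

Lemma inside_A r x : r ∈ I -> x ∈ A -> inside r x.
Proof.
  intros Hr Hx; destruct (family_value r Hr) as (w & Uw & _ & Ew).
  apply Ew; now apply (proj1 (proj2 (proj2 HU)) r w Hr Uw).
Qed.

Lemma outside_B r x : r ∈ I -> x ∈ B -> ~ inside r x.
Proof.
  intros Hr Hx H; destruct (family_value r Hr) as (w & Uw & _ & Ew).
  destruct (proj2 (proj2 (proj2 HU)) r w Hr Uw) as (c & D & Hc & HD & CD).
  assert (x ∈ D) as Hd by (apply CD, (subset_closure c w Hc); now apply Ew).
  now apply HD in Hd.
Qed.

(** The function sends [x] to the supremum of its indices. Zero is included so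
    that there is always one; this also makes the function vanish on [A]. *)
Definition index (x s : M) : Prop := s = zero \/ s ∈ I /\ ~ inside s x.

Definition is_index_sup (x y : M) : Prop :=
  (forall s, index x s -> lesseq lt s y) /\
  forall b, b ∈ R -> (forall s, index x s -> lesseq lt s b) -> lesseq lt y b.

Lemma index_R x s : index x s -> s ∈ R.
Proof. intros [->|[H _]]; [exact zero_R|now apply I_bounds]. Qed.

Lemma index_le_one x s : index x s -> lesseq lt s one.
Proof. intros [->|[H _]]; left; [exact zero_one|now apply I_bounds]. Qed.

Lemma lt_not_lesseq x y : x ∈ R -> y ∈ R -> related lt x y -> ~ lesseq lt y x.
Proof.
  intros Hx Hy L [L'|E]; apply (lt_irrefl_R x Hx); [eauto|now rewrite E in L].
Qed.

Lemma lesseq_or_lt x y : x ∈ R -> y ∈ R -> lesseq lt x y \/ related lt y x.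
Proof.
  intros Hx Hy; destruct (lt_total_R x y Hx Hy) as [L|[E|L]];
    [now left; left|now left; right|now right].
Qed.

Lemma lesseq_lt_trans x y z : x ∈ R -> y ∈ R -> z ∈ R ->
  lesseq lt x y -> related lt y z -> related lt x z.
Proof. intros Hx Hy Hz [L| ->]; [now apply lt_trans_R|trivial]. Qed.

Lemma lt_lesseq_trans x y z : x ∈ R -> y ∈ R -> z ∈ R ->
  related lt x y -> lesseq lt y z -> related lt x z.
Proof. intros Hx Hy Hz L [L'| <-]; [now apply lt_trans_R with y|trivial]. Qed.

Lemma index_sup_exists x : exists y, y ∈ R /\ is_index_sup x y.
Proof.
  destruct (separation R (index x)) as [S HS].
  { unfold index, inside; definable. }
  assert (HS' : forall s, s ∈ S <-> index x s).
  { intros s; rewrite HS; split; [tauto|]; intros H; split; [now apply (index_R x)|exact H]. }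
  destruct (R_complete S) as (y & Ry & Ub & L).
  - intros s Hs; now apply HS in Hs.
  - exists zero; apply HS'; now left.
  - exists one; split; [exact one_R|]; intros s Hs; now apply (index_le_one x), HS'.
  - exists y; split; [exact Ry|split].
    + intros s Hs; now apply Ub, HS'.
    + intros b Hb H; apply L; [exact Hb|]; intros s Hs; now apply H, HS'.
Qed.

Lemma index_sup_unique x y z : y ∈ R -> z ∈ R ->
  is_index_sup x y -> is_index_sup x z -> z = y.
Proof.
  intros Hy Hz [Uy Ly] [Uz Lz].
  destruct (Ly z Hz Uz) as [L|E]; [|now symmetry].
  destruct (lt_not_lesseq y z Hy Hz L (Lz y Hy Uy)).
Qed.

Lemma index_sup_bounds x y : is_index_sup x y -> lesseq lt zero y /\ lesseq lt y one.
Proof.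
  intros [Uy Ly]; split; [apply Uy; now left|].
  apply Ly; [exact one_R|apply index_le_one].
Qed.

(** If the supremum is below [a], an index strictly between the two cannot have
    [x] outside its set. *)
Lemma index_sup_lt x y a : y ∈ R -> a ∈ R -> is_index_sup x y ->
  related lt y a <->
  related lt one a \/ exists r, r ∈ I /\ related lt r a /\ inside r x.
Proof.
  intros Ry Ra H; destruct (index_sup_bounds x y H) as [Y0 Y1]; split.
  - intros L; destruct (lesseq_or_lt a one Ra one_R) as [A1|A1]; [right|now left].
    destruct (I_dense y a Ry Ra Y0 L A1) as (r & Hr & L1 & L2).
    exists r; repeat split; trivial; apply NNPP; intros N1.
    apply (lt_not_lesseq y r Ry (proj1 (I_bounds r Hr)) L1).
    apply (proj1 H); now right.
  - intros [L|(r & Hr & L & Hi)]; [now apply lesseq_lt_trans with one|].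
    destruct (I_bounds r Hr) as (Rr & Pr & _).
    apply lesseq_lt_trans with r; trivial; apply (proj2 H); [exact Rr|].
    intros s [->|[Hs No]]; [now left|].
    destruct (I_bounds s Hs) as (Rs & _).
    destruct (lesseq_or_lt s r Rs Rr) as [Ls|Ls]; [exact Ls|].
    destruct No; now apply inside_mono with r.
Qed.

(** If the supremum is above [a], some index [s > a] has [x] outside [U_s]; a
    second index [r] between [a] and [s] turns this into an open condition. *)
Lemma index_sup_gt x y a : y ∈ R -> a ∈ R -> x ∈ X -> is_index_sup x y ->
  related lt a y <->
  related lt a zero \/ exists r, r ∈ I /\ related lt a r /\
    exists o, o ∈ mu /\ x ∈ o /\ forall z, z ∈ o -> ~ inside r z.
Proof.
  intros Ry Ra Xx H; destruct (index_sup_bounds x y H) as [Y0 Y1]; split.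
  - intros L; destruct (lesseq_or_lt zero a zero_R Ra) as [A0|A0]; [right|now left].
    assert (exists s, s ∈ I /\ related lt a s /\ ~ inside s x) as (s & Hs & Ls & No).
    { apply NNPP; intros G; apply (lt_not_lesseq a y Ra Ry L), (proj2 H); [exact Ra|].
      intros s [->|[Hs No]]; [exact A0|].
      destruct (I_bounds s Hs) as (Rs & _).
      destruct (lesseq_or_lt s a Rs Ra) as [Ls|Ls]; [exact Ls|].
      destruct G; now exists s. }
    destruct (I_bounds s Hs) as (Rs & _ & S1).
    destruct (I_dense a s Ra Rs A0 Ls (or_introl S1)) as (r & Hr & L1 & L2).
    exists r; repeat split; trivial; now apply outside_open with s.
  - intros [L|(r & Hr & L & o & _ & Ho & D)]; [now apply lt_lesseq_trans with zero|].
    destruct (I_bounds r Hr) as (Rr & _).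
    apply lt_lesseq_trans with r; trivial; apply (proj1 H); right.
    split; [exact Hr|now apply D].
Qed.

Lemma function_of_family : exists f, Sem.urysohn_function mem X mu R N zero one A B f.
Proof.
  destruct (function_exists X R is_index_sup) as (f & Hf & V).
  { unfold is_index_sup, index, inside; definable. }
  { intros x _; destruct (index_sup_exists x) as (y & Ry & Hy).
    exists y; repeat split; trivial; try apply Hy.
    intros z Rz Hz; now apply (index_sup_unique x). }
  assert (T : forall x, x ∈ X -> exists y, related f x y /\ y ∈ R /\ is_index_sup x y).
  { intros x Hx; destruct (proj2 Hf x Hx) as (y & Hy & _); exists y.
    split; [exact Hy|]; now apply V. }
  assert (T' : forall x y, related f x y -> x ∈ X /\ y ∈ R /\ is_index_sup x y).
  { intros x y H; destruct (fun_dom_cod _ _ _ _ _ Hf H) as [Hx _].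
    split; [exact Hx|now apply V]. }
  exists f; split; [exact Hf|split; [|split]].
  - (* The disjuncts with [w = X] account for rays that contain all of [0, 1]. *)
    apply continuous_of_rays; [exact Hf| |]; intros a Ra.
    + destruct (open_union (fun w => (related lt one a /\ w = X) \/
        exists r, r ∈ I /\ related lt r a /\ related U r w)) as (u & Mu & Hu); [definable|].
      exists u; split; [exact Mu|]; intros x; rewrite Hu; split.
      * intros (w & Mw & Hw & Hx); destruct (T x (open_subset w Mw x Hx)) as (y & Hy & Ry & S).
        exists y; split; [exact Hy|]; apply (index_sup_lt x y a Ry Ra S).
        destruct Hw as [[L _]|(r & Hr & L & Ur)]; [now left|right].
        exists r; repeat split; trivial; now exists w.
      * intros (y & Hy & L); destruct (T' x y Hy) as (Hx & Ry & S).
        apply (index_sup_lt x y a Ry Ra S) in L as [L|(r & Hr & L & w & Uw & Hw)].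
        -- exists X; repeat split; trivial; [apply HX|left; auto].
        -- exists w; repeat split; trivial; [|right; now exists r].
           now apply (fun_dom_cod _ _ _ _ _ (proj1 HU)) in Uw.
    + destruct (open_union (fun w => (related lt a zero /\ w = X) \/
        exists r, r ∈ I /\ related lt a r /\ forall z, z ∈ w -> ~ inside r z))
        as (u & Mu & Hu); [unfold inside; definable|].
      exists u; split; [exact Mu|]; intros x; rewrite Hu; split.
      * intros (w & Mw & Hw & Hx); destruct (T x (open_subset w Mw x Hx)) as (y & Hy & Ry & S).
        exists y; split; [exact Hy|].
        apply (index_sup_gt x y a Ry Ra (open_subset w Mw x Hx) S).
        destruct Hw as [[L _]|(r & Hr & L & D)]; [now left|right].
        exists r; repeat split; trivial; now exists w.
      * intros (y & Hy & L); destruct (T' x y Hy) as (Hx & Ry & S).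
        apply (index_sup_gt x y a Ry Ra Hx S) in L as [L|(r & Hr & L & w & Mw & Hw & D)].
        -- exists X; repeat split; trivial; [apply HX|left; auto].
        -- exists w; repeat split; trivial; right; now exists r.
  - intros x Hx; destruct (T x (AX x Hx)) as (y & Hy & Ry & S).
    replace zero with y; [exact Hy|].
    apply (index_sup_unique x); trivial; split.
    + intros s [->|[Hs No]]; [now right|]; destruct No; now apply inside_A.
    + intros b _ H; apply H; now left.
  - intros x Hx; destruct (T x (BX x Hx)) as (y & Hy & Ry & S).
    replace one with y; [exact Hy|].
    destruct (index_sup_bounds x y S) as [Y0 [Y1|Y1]]; [|exact Y1].
    destruct (I_dense y one Ry one_R Y0 Y1) as (r & Hr & L1 & _); [now right|].
    destruct (lt_not_lesseq y r Ry (proj1 (I_bounds r Hr)) L1).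
    apply (proj1 S); right; split; [exact Hr|now apply outside_B].
Qed.

End FunctionOfFamily.

Theorem urysohn_characterization :
  Sem.GUL mem X mu R N zero one <->
  forall A B, nonempty A -> nonempty B -> disjoint A B ->
    is_closed X mu A -> is_closed X mu B ->
    exists U, Sem.urysohn_family mem X mu lt I A B U.
Proof.
  split.
  - intros G A B _ _ D CA CB; destruct (G A B CA CB D) as [f Hf].
    apply (family_of_function A B f); [apply CA|exact Hf].
  - intros G A B CA CB D.
    destruct (classic (nonempty A)) as [NA|NA].
    2: { destruct (constant_function one one_R) as (f & Hf & Cf & V).
         exists f; repeat split; try apply Hf; trivial.
         - intros x Hx; destruct NA; now exists x.
         - intros x Hx; apply V; now apply CB. }
    destruct (classic (nonempty B)) as [NB|NB].
    2: { destruct (constant_function zero zero_R) as (f & Hf & Cf & V).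
         exists f; repeat split; try apply Hf; trivial.
         - intros x Hx; apply V; now apply CA.
         - intros x Hx; destruct NB; now exists x. }
    destruct (G A B NA NB D CA CB) as [U HU].
    apply (function_of_family A B U); [apply CA|apply CB|exact HU].
Qed.

End Urysohn.
End Topology.

Theorem model_satisfies_characterization : Sem.characterization mem.
Proof.
  intros R add mul lt zero one Q I N HR HQ HI HN X mu HX.
  destruct (rationals_dense R add mul lt zero one Q HR HQ) as [H01 HD].
  destruct HR as [(_ & (H0 & H1 & _) & _ & _ & _ & _ & _ & _ & _ & _ & _ & ltI & ltT & ltC & _)
    HC].
  assert (QR : subset Q R) by exact (proj1 (proj1 HQ)).
  apply urysohn_characterization; trivial.
  - intros r Hr; apply HI in Hr as [Hr L]; split; [now apply QR|exact L].
  - intros x y Hx Hy L0 L L1; destruct (HD x y Hx Hy L) as (q & Hq & Lx & Ly).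
    assert (q ∈ R) by now apply QR.
    exists q; repeat split; trivial; apply HI; repeat split; trivial.
    + destruct L0 as [L0| ->]; [now apply ltT with x|exact Lx].
    + destruct L1 as [L1| <-]; [now apply ltT with y|exact Ly].
Qed.

End Model.

Theorem proposition3p1 :
  provable ZF (sentence (
    ∀ R add mul lt zero one Q I N,
      real_field R add mul lt zero one →
      rational_subfield Q R add mul zero one →
      rational_unit_interval I Q lt zero one →
      is_gtau_n N R lt →
    ∀ X mu, strong_gen_top X mu →
      (GUL X mu R N zero one ↔
       ∀ A B, nonempty A → nonempty B → disjoint A B →
         is_closed X mu A → is_closed X mu B →
         ∃ U, is_fun U I mu ∧
           (∀ r s Ur Us, r ∈ I → s ∈ I → value U r Ur → value U s Us →
              less lt r s → ∃ C, is_closure X mu C Ur ∧ subset C Us) ∧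
           (∀ r Ur, r ∈ I → value U r Ur → subset A Ur) ∧
           (∀ r Ur, r ∈ I → value U r Ur →
              ∃ C D, is_closure X mu C Ur ∧ is_diff D X B ∧ subset C D))))%fm.
Proof.
  apply completeness; intros M mem H rho; apply reading_sat.
  exact (model_satisfies_characterization mem H).
Qed.
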